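(* Suppose that $\{X^x_t\}_{t\ge0}$ and its numerical discretization $\{Y^{x^h,\Delta}_{t_k}\}_{k\in\mathbb N}$ satisfy conditions (A1), (A2) and (A3) of the context. Let $\gamma\in[\gamma_2,1]$ and let $p\ge1$ satisfy $p(1+\tilde q)+2(1+\kappa)\gamma\le q$. Let $\mu$ be the unique invariant measure of $\{X^x_t\}_{t\ge 0}$. Then for any $f\in\mathcal C_{p,\gamma}(E;\mathbb R)$ and any $x\in E$, $$\lim_{|\Delta|\to0}\ \lim_{k\to\infty}\ \frac1k\sum_{i=0}^{k-1}f\big(Y^{x^h,\Delta}_{t_i}\big)=\mu(f)\quad\text{a.s.},$$ where the inner limit is taken almost surely for each fixed step-size $\Delta$.
   Context: Spaces. $(E,\|\cdot\|)$ is a real separable Banach space with Borel $\sigma$-algebra $\mathfrak B(E)$; $\nu(f):=\int_E f\,\mathrm d\nu$ for a probability measure $\nu$. For $p\ge1$, $\gamma\in(0,1]$, let $d_{p,\gamma}(u_1,u_2):=(1\wedge\|u_1-u_2\|^{\gamma})(1+\|u_1\|^p+\|u_2\|^p)^{1/2}$, and let $\mathcal C_{p,\gamma}=\mathcal C_{p,\gamma}(E;\mathbb R)$ be the set of continuous $f:E\to\mathbb R$ with finite norm $$\|f\|_{p,\gamma}:=\sup_{u\in E}\frac{|f(u)|}{1+\|u\|^{p/2}}+\sup_{u_1\ne u_2}\frac{|f(u_1)-f(u_2)|}{d_{p,\gamma}(u_1,u_2)}.$$ Processes. On a filtered probability space $(\Omega,\mathcal F,\{\mathcal F_t\}_{t\ge0},\mathbb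 P)$, $\{X^x_t\}_{t\ge0}$, $x\in E$, is a family of $E$-valued time-homogeneous Markov processes with $X^x_0=x$ deterministic. The step-size is $\Delta=(h,\tau)^\top\in[0,1]\times(0,1]$ ($h$ spatial, $\tau$ temporal; $h=0$ when only time is discretized), and $t_k:=k\tau$. $E^h\subset E$ is the state space of the discretization, with the norm of $E$; $E^0:=E$; for $h\neq0$ (full discretization) $E^h$ is finite dimensional. $\{Y^{x^h,\Delta}_{t_k}\}_{k\in\mathbb N}$ is the $E^h$-valued discretization of $\{X^x_t\}$ with $Y^{x^h,\Delta}_0=x^h\in E^h$, where $x^h$ is the approximation of $x$ in $E^h$ ($x^h=x$ if $x\in E^h$); set $Y^{x^h,\Delta}_t:=Y^{x^h,\Delta}_{t_k}$ for $t\in[t_k,t_{k+1})$. (A1) (i) There are $r\ge2$, $\tilde r\ge1$, $L_1>0$ with $\sup_{t\ge0}\mathbb E[\|X^x_t\|^r]\le L_1(1+\|x\|^{\tilde r r})$ for all $x\in E$. (ii) There are $\gamma_1\in(0,1]$, $\beta\in[0,r-1]$, $L_2>0$ and a continuous $\rho:[0,\infty)\to[0,\infty)$ with $\int_0^\infty\rho^{\gamma_1}(t)\,\mathrm dt<\infty$ such that $(\mathbb E[\|X^x_t-X^y_t\|^2])^{1/2}\le L_2\|x-y\|(1+\|x\|^\beta+\|y\|^\beta)\rho(t)$ for all $x,y\in E$, $t\ge 0$. (Under (A1), $\{X^x_t\}$ has a unique invariant measure $\mu$.) (A2) There is $\tilde\Delta=(\tilde h,\tilde\tau)^\top\in[0,1]\times(0,1]$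 such that for all $h\in[0,\tilde h]$, $\tau\in(0,\tilde\tau]$, $x^h\in E^h$, the sequence $\{Y^{x^h,\Delta}_{t_k}\}_{k\in\mathbb N}$ is time-homogeneous Markov and: (i) $\sup_{k\ge0}\mathbb E[\|Y^{x^h,\Delta}_{t_k}\|^q]\le L_3(1+\|x^h\|^{\tilde q q})$ for constants $q\ge2$, $\tilde q\ge1$, $L_3>0$; (ii) there are $\gamma_2\in(0,1]$, $\kappa\in[0,q-1]$, $L_4>0$ and $\rho^\Delta:[0,\infty)\to[0,\infty)$ with $\sup_{h\in[0,\tilde h],\tau\in(0,\tilde\tau]}\tau\sum_{k=0}^\infty(\rho^\Delta(t_k))^{\gamma_2}<\infty$ such that $(\mathbb E[\|Y^{x^h,\Delta}_{t_k}-Y^{y^h,\Delta}_{t_k}\|^2])^{1/2}\le L_4\|x^h-y^h\|(1+\|x^h\|^\kappa+\|y^h\|^\kappa)\rho^\Delta(t_k)$ for all $x^h,y^h\in E^h$, $k\in\mathbb N$. The constants $q,\tilde q,L_3,\gamma_2,\kappa,L_4$ do not depend on $\Delta$. (A3) There are $\alpha=(\alpha_1,\alpha_2)^\top$ with $\alpha_1,\alpha_2>0$ and $L_5>0$ such that for all $x\in E$, $\sup_{t\ge0}(\mathbb E[\|X^x_t-Y^{x^h,\Delta}_t\|^2])^{1/2}\le L_5(1+\|x\|^{\tilde r\vee\tilde q})|\Delta^\alpha|$, where $|\Delta^\alpha|:=h^{\alpha_1}+\tau^{\alpha_2}$. Throughout, $h\in[0,\tilde h]$, $\tau\in(0,\tilde\tau]$,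 and $r$, $q$ are assumed as large as needed. *)

(* Defs.v *)
From HB Require Import structures.
From mathcomp Require Import all_boot all_order all_algebra.
From mathcomp Require Import all_classical all_reals all_analysis.
From mathcomp Require Import measurable_realfun.

Set Implicit Arguments.
Unset Strict Implicit.
Unset Printing Implicit Defensive.

Import Order.TTheory GRing.Theory Num.Theory.
Import numFieldNormedType.Exports.

Local Open Scope classical_set_scope.
Local Open Scope ring_scope.

Notation borel E := (g_sigma_algebraType (@open E)).

Definition separable (T : topologicalType) : Prop :=
  exists D : set T, countable D /\ dense D.

Definition dpg (R : realType) (E : completeNormedModType R) (p gamma : R)
    (u1 u2 : E) : R :=
  Num.min 1 (`|u1 - u2| `^ gamma) *
  Num.sqrt (1 + `|u1| `^ p + `|u2| `^ p).

(* In the second supremum the pairs u1 = u2 contribute 0 / 0 = 0, hence they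
   change nothing; they make that supremum 0, not -oo, when E is trivial. *)
Definition norm_pg (R : realType) (E : completeNormedModType R) (p gamma : R)
    (f : E -> R) : \bar R :=
  (ereal_sup [set (`|f u| / (1 + `|u| `^ (p / 2)))%:E | u in [set: E]] +
   ereal_sup [set (`|f u.1 - f u.2| / dpg p gamma u.1 u.2)%:E
             | u in [set: E * E]])%E.

Definition Cpg (R : realType) (E : completeNormedModType R) (p gamma : R)
    (f : E -> R) : Prop :=
  continuous f /\ (norm_pg p gamma f < +oo)%E.

Definition filtration (R : realType) d (Omega : measurableType d)
    (F : R -> set (set Omega)) : Prop :=
  [/\ forall t : R, 0 <= t -> sigma_algebra [set: Omega] (F t),
      forall t : R, 0 <= t -> F t `<=` measurable
    & forall s t : R, 0 <= s -> s <= t -> F s `<=` F t].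

Definition natural_filtration (R : realType) (E : completeNormedModType R) d
    (Omega : measurableType d) (Z : nat -> {mfun Omega >-> borel E})
    (k : nat) : set (set Omega) :=
  <<s [set B | exists j (A : set (borel E)),
         [/\ (j <= k)%N, measurable A & B = Z j @^-1` A] ] >>.

(* A time-homogeneous Markov family, indexed by its starting point in the
   state space S, with time set T.  Its transition kernel is
   (y, A) |-> P (X y t \in A), and the last clause is the Markov property
   P (X x (s + t) \in A | F x s) = P (X y t \in A) at y = X x s.  The filtration
   may depend on the starting point. *)
Record markov_family (R : realType) (E : completeNormedModType R) d
    (Omega : measurableType d) (P : probability Omega R) (I : nmodType)
    (S : set E) (T : set I) (F : E -> I -> set (set Omega))
    (X : E -> I -> {mfun Omega >-> borel E}) : Prop := MarkovFamily {
  markov_state : forall x t w, S x -> T t -> S (X x t w) ;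
  markov_start : forall x w, S x -> X x 0 w = x ;
  markov_adapted : forall x t (A : set (borel E)), S x -> T t ->
    measurable A -> F x t (X x t @^-1` A) ;
  markov_kernel : forall t (A : set (borel E)), T t -> measurable A ->
    measurable_fun (S : set (borel E))
      (fun y : borel E => P (X y t @^-1` A)) ;
  markov_property : forall x s t (A : set (borel E)) (B : set Omega),
    S x -> T s -> T t -> measurable A -> F x s B ->
    P (B `&` X x (s + t) @^-1` A) =
    (\int[P]_(w in B) P (X (X x s w) t @^-1` A))%E
}.

Definition markov_process (R : realType) (E : completeNormedModType R) d
    (Omega : measurableType d) (P : probability Omega R)
    (F : R -> set (set Omega)) (X : E -> R -> {mfun Omega >-> borel E}) :=
  markov_family P [set: E] [set t : R | 0 <= t] (fun _ => F) X.

Definition markov_chain (R : realType) (E : completeNormedModType R) d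
    (Omega : measurableType d) (P : probability Omega R) (S : set E)
    (Y : E -> nat -> {mfun Omega >-> borel E}) :=
  markov_family P S [set: nat] (fun x => natural_filtration (Y x)) Y.

Definition invariant_measure (R : realType) (E : completeNormedModType R) d
    (Omega : measurableType d) (P : probability Omega R)
    (X : E -> R -> {mfun Omega >-> borel E})
    (nu : probability (borel E) R) : Prop :=
  forall (t : R) (A : set (borel E)), 0 <= t -> measurable A ->
    nu A = (\int[nu]_x P (X x t @^-1` A))%E.

Definition unique_invariant_measure (R : realType)
    (E : completeNormedModType R) d (Omega : measurableType d)
    (P : probability Omega R) (X : E -> R -> {mfun Omega >-> borel E})
    (mu : probability (borel E) R) : Prop :=
  invariant_measure P X mu /\
  forall nu : probability (borel E) R, invariant_measure P X nu ->
    forall A : set (borel E), measurable A -> nu A = mu A.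

(* A step-size is a pair D = (h, tau), h in space and tau in time. *)
Definition steps (R : realType) (D0 : R * R) : set (R * R) :=
  [set D | 0 <= D.1 <= D0.1 /\ 0 < D.2 <= D0.2].

Definition finite_dim_subspace (R : realType) (E : completeNormedModType R)
    (S : set E) : Prop :=
  exists n (e : 'I_n -> E),
    S = [set \sum_(i < n) c i *: e i | c in [set: 'I_n -> R]].

Record discretization_space (R : realType) (E : completeNormedModType R)
    (Eh : R -> set E) (proj : R -> E -> E) : Prop := DiscretizationSpace {
  space0 : Eh 0 = [set: E] ;
  space_finite_dim : forall h : R, 0 < h <= 1 -> finite_dim_subspace (Eh h) ;
  proj_in : forall (h : R) x, 0 <= h <= 1 -> Eh h (proj h x) ;
  proj_id : forall (h : R) x, 0 <= h <= 1 -> Eh h x -> proj h x = x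
}.

(* Y t_k on [t_k, t_(k+1)), where t_k = k tau *)
Definition step_process (R : realType) (E : completeNormedModType R) d
    (Omega : measurableType d) (tau : R)
    (Y : nat -> {mfun Omega >-> borel E}) (t : R) :
    {mfun Omega >-> borel E} :=
  Y (Num.truncn (t / tau)).

Definition L2dist (R : realType) (E : completeNormedModType R) d
    (Omega : measurableType d) (P : probability Omega R)
    (X Y : {mfun Omega >-> borel E}) : \bar R :=
  Lnorm P 2%:E (fun w => (`|(X w : E) - Y w|)%:E).

Definition moment (R : realType) (E : completeNormedModType R) d
    (Omega : measurableType d) (P : probability Omega R) (r : R)
    (X : {mfun Omega >-> borel E}) : \bar R :=
  ('E_P[(fun w => `|X w : E| `^ r)%R])%E.

Record condA1 (R : realType) (E : completeNormedModType R) d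
    (Omega : measurableType d) (P : probability Omega R)
    (X : E -> R -> {mfun Omega >-> borel E})
    (r rt L1 gamma1 beta L2 : R) (rho : R -> R) : Prop := CondA1 {
  A1_r : 2 <= r ;
  A1_rt : 1 <= rt ;
  A1_L1 : 0 < L1 ;
  A1_moment : forall x (t : R), 0 <= t ->
    (moment P r (X x t) <= (L1 * (1 + `|x| `^ (rt * r)))%:E)%E ;
  A1_gamma1 : 0 < gamma1 <= 1 ;
  A1_beta : 0 <= beta <= r - 1 ;
  A1_L2 : 0 < L2 ;
  A1_rho_ge0 : forall t : R, 0 <= t -> 0 <= rho t ;
  A1_rho_cont : {within `[0, +oo[, continuous rho} ;
  A1_rho_int :
    (\int[lebesgue_measure]_(t in `[0%R, +oo[)
       (rho t `^ gamma1)%:E < +oo)%E ;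
  A1_contr : forall x y t, 0 <= t ->
    (L2dist P (X x t) (X y t) <=
     (L2 * `|x - y| * (1 + `|x| `^ beta + `|y| `^ beta) * rho t)%:E)%E
}.

Record condA2 (R : realType) (E : completeNormedModType R) d
    (Omega : measurableType d) (P : probability Omega R)
    (Eh : R -> set E) (Y : R * R -> E -> nat -> {mfun Omega >-> borel E})
    (D0 : R * R) (q qt L3 gamma2 kappa L4 : R) (rhoD : R * R -> R -> R)
    : Prop := CondA2 {
  A2_range : 0 <= D0.1 <= 1 /\ 0 < D0.2 <= 1 ;
  A2_markov : forall D, steps D0 D -> markov_chain P (Eh D.1) (Y D) ;
  A2_q : 2 <= q ;
  A2_qt : 1 <= qt ;
  A2_L3 : 0 < L3 ;
  A2_moment : forall D x k, steps D0 D -> Eh D.1 x ->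
    (moment P q (Y D x k) <= (L3 * (1 + `|x| `^ (qt * q)))%:E)%E ;
  A2_gamma2 : 0 < gamma2 <= 1 ;
  A2_kappa : 0 <= kappa <= q - 1 ;
  A2_L4 : 0 < L4 ;
  A2_rho_ge0 : forall D (t : R), steps D0 D -> 0 <= t -> 0 <= rhoD D t ;
  A2_rho_sum :
    (ereal_sup [set D.2%:E *
        \sum_(0 <= k <oo) (rhoD D (k%:R * D.2) `^ gamma2)%:E
      | D in steps D0] < +oo)%E ;
  A2_contr : forall D x y k, steps D0 D -> Eh D.1 x -> Eh D.1 y ->
    (L2dist P (Y D x k) (Y D y k) <=
     (L4 * `|x - y| * (1 + `|x| `^ kappa + `|y| `^ kappa) *
      rhoD D (k%:R * D.2))%:E)%E
}.

Record condA3 (R : realType) (E : completeNormedModType R) d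
    (Omega : measurableType d) (P : probability Omega R)
    (X : E -> R -> {mfun Omega >-> borel E}) (proj : R -> E -> E)
    (Y : R * R -> E -> nat -> {mfun Omega >-> borel E})
    (D0 : R * R) (rt qt alpha1 alpha2 L5 : R) : Prop := CondA3 {
  A3_alpha : 0 < alpha1 /\ 0 < alpha2 ;
  A3_L5 : 0 < L5 ;
  A3_error : forall D x (t : R), steps D0 D -> 0 <= t ->
    (L2dist P (X x t) (step_process D.2 (Y D (proj D.1 x)) t) <=
     (L5 * (1 + `|x| `^ Num.max rt qt) *
      (D.1 `^ alpha1 + D.2 `^ alpha2))%:E)%E
}.

Definition time_average (R : realType) (E : completeNormedModType R) d
    (Omega : measurableType d) (f : E -> R)
    (Y : nat -> {mfun Omega >-> borel E}) (k : nat) (w : Omega) : R :=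
  k%:R^-1 * \sum_(i < k) f (Y i w).

(* Main.v *)
Require Import Defs.
From HB Require Import structures.
From mathcomp Require Import all_boot all_order all_algebra.
From mathcomp Require Import finmap.
From mathcomp Require Import all_classical all_reals all_analysis.
From mathcomp Require Import measurable_realfun.
From mathcomp Require Import ring lra zify.

Import Order.TTheory GRing.Theory Num.Theory.
Import numFieldNormedType.Exports.

Local Open Scope classical_set_scope.
Local Open Scope ring_scope.

(* Fix a step-size D and write e k y for the mean of f at time t_k of the chain
   started at y.  Contraction (A2) and the growth of f give
   |e k y - e k z| <= C rho_k^gamma2 v(y) v(z) with a polynomial weight v, so the
   Markov property yields |e (n + k) x - e k y| <= C' rho_k^gamma2 v(y).  Hence
   e k x converges to a constant a, and the centred variables f(Y_k) - a have
   summable covariances: their partial sums S_n satisfy E[S_n^2] = O(n), and the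
   strong law follows along the squares n^2, the gaps between consecutive squares
   being negligible.  The limit Z D is thus the constant a, and no invariant
   measure of the chain is needed.
   For X, integrability of rho^gamma1 provides times t_n -> oo with
   rho(t_n) -> 0; along them contraction and invariance of mu give
   E[f(X_{t_n})] -> mu(f), first for bounded truncations of f.  The moments of X
   that are missing in (A1) are inherited from the discretizations with h = 0 and
   tau -> 0.  Finally (A3) bounds |mu(f) - a| by a constant times
   (h^alpha1 + tau^alpha2)^gamma2, because it compares E[f(X_{t_n})] with the
   mean of f along the chain uniformly in n. *)

(** * Monotone class arguments *)

(** The weight enters as a product [v(y) v(z)] so that averaging in [z] over the law of the chain,
    whose moments of order [q] are bounded in time, leaves a constant times [v(y)]. With [f] of
    growth [p / 2] and [v] of degree [(1 + kappa) gamma2 + qt p], the covariances need moments of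
    order [p / 2 + (1 + kappa) gamma2 + qt p], which the hypothesis on [p], [gamma] and [q] keeps at
    most [q]. The exponent drops from [gamma] to [gamma2] because (A2) sums only the powers
    [rho_k^gamma2]; the truncation by 1 in [dpg] permits this. For [X] only a sequence of times is
    available, since a continuous [rho] with an integrable power need not tend to 0 at infinity.
    Bounded truncations come first because no moment of [mu] is known beforehand; integrability of
    [f] under [mu] comes out of the limit. Pointwise Young inequalities stand in for Cauchy-Schwarz
    and Jensen, which accounts for many of the numerical constants. *)

Section MeasurableInduction.
Context {d : measure_display} {T : measurableType d} {R : realType}.
Local Open Scope ereal_scope.

Import HBNNSimple.

(** The simple functions [nnsfun_approx] increase to [f], and each is a finite sum of nonnegative
    multiples of indicators of its level sets. The closure hypotheses receive measurability and
    nonnegativity so that additivity and monotone convergence of the integral are at hand when they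
    are proved. *)
Lemma ge0_measurable_fun_ind (Q : (T -> \bar R) -> Prop) :
  (forall A, measurable A -> Q (fun x => (\1_A x)%:E)) ->
  (forall (a : R) f, (0 <= a)%R -> measurable_fun [set: T] f ->
    (forall x, 0 <= f x) -> Q f -> Q (fun x => a%:E * f x)) ->
  (forall f g, measurable_fun [set: T] f -> (forall x, 0 <= f x) ->
    measurable_fun [set: T] g -> (forall x, 0 <= g x) ->
    Q f -> Q g -> Q (fun x => f x + g x)) ->
  (forall f_ : (T -> \bar R)^nat, (forall n, measurable_fun [set: T] (f_ n)) ->
    (forall n x, 0 <= f_ n x) -> (forall x, nondecreasing_seq (f_ ^~ x)) ->
    (forall n, Q (f_ n)) -> Q (fun x => limn (f_ ^~ x))) ->
  forall f, measurable_fun [set: T] f -> (forall x, 0 <= f x) -> Q f.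
Proof.
move=> Qind Qscale Qadd Qlim f mf f0.
pose h := nnsfun_approx measurableT mf.
have -> : f = (fun x => limn (fun n => (h n x)%:E)).
  apply/funext => x; apply/esym/cvg_lim => //.
  exact: (cvg_nnsfun_approx measurableT mf (fun x _ => f0 x)).
apply: (Qlim (fun n x => (h n x)%:E)).
- by move=> n; exact/measurable_EFinP.
- by move=> n x; rewrite lee_fin.
- by move=> x a b ab; rewrite lee_fin; exact/lefP/nd_nnsfun_approx.
move=> n.
pose s : seq R := fset_set (range (h n)).
have -> : (fun x => (h n x)%:E) =
    (fun x => \sum_(y <- s) (y * \1_(h n @^-1` [set y]) x)%:E).
  apply/funext => x; rewrite fimfunE fsbig_finite//= sumEFin//.
have : all (>= 0)%R s.
  apply/allP => y; rewrite /s in_fset_set// inE => -[t _ <-] /=.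
  exact: fun_ge0.
have ms y : measurable_fun [set: T] (fun x => (y * \1_(h n @^-1` [set y]) x)%:E).
  by apply/measurable_EFinP; apply: measurable_funM => //; exact: measurable_indic.
elim: s => [_|y s' IH /= /andP[y0 s0]].
  (* The empty sum is the indicator of the empty set. *)
  under eq_fun do rewrite big_nil.
  have := Qind set0 measurable0; congr (Q _).
  by apply/funext => x; rewrite indic0.
under eq_fun do rewrite big_cons.
apply: Qadd => //.
- by move=> x; rewrite lee_fin mulr_ge0.
- exact: emeasurable_sum.
- move=> x; rewrite big_seq; apply: sume_ge0 => z /(allP s0) z0.
  by rewrite lee_fin mulr_ge0.
- under eq_fun do rewrite EFinM.
  apply: Qscale => //; first by apply/measurable_EFinP; exact: measurable_indic.
  exact: Qind.
- exact: IH.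
Qed.

End MeasurableInduction.

(** * Kernel identities, from sets to functions *)

Section Disintegration.
Context {R : realType}.
Local Open Scope ereal_scope.

(** The defining property of a conditional expectation given [V], passed from indicators to all
    nonnegative [h]. Finiteness of [phi] and [psi] lets them be pulled out of a monotone limit whose
    value may be [+oo]. *)
Lemma tower_ge0 d d' (T : measurableType d) (S : measurableType d')
    (P : {measure set T -> \bar R})
    (V : {mfun T >-> S}) (phi psi : T -> \bar R) :
  measurable_fun [set: T] phi -> (forall w, 0 <= phi w < +oo) ->
  measurable_fun [set: T] psi -> (forall w, 0 <= psi w < +oo) ->
  (forall A, measurable A ->
     \int[P]_(w in V @^-1` A) phi w = \int[P]_(w in V @^-1` A) psi w) ->
  forall h : S -> \bar R, measurable_fun [set: S] h -> (forall x, 0 <= h x) ->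
  \int[P]_w (h (V w) * phi w) = \int[P]_w (h (V w) * psi w).
Proof.
move=> mphi phi0y mpsi psi0y phipsi h mh h0.
have phi0 w : 0 <= phi w by have /andP[] := phi0y w.
have psi0 w : 0 <= psi w by have /andP[] := psi0y w.
have mcomp (g : S -> \bar R) : measurable_fun [set: S] g ->
    measurable_fun [set: T] (g \o V) by move=> mg; exact: measurableT_comp.
pose Q (g : S -> \bar R) :=
  \int[P]_w (g (V w) * phi w) = \int[P]_w (g (V w) * psi w).
apply: (@ge0_measurable_fun_ind _ S R Q _ _ _ _ h mh h0) => {h mh h0}.
- move=> A mA; rewrite /Q.
  have ind (k : T -> \bar R) : \int[P]_w ((\1_A (V w))%:E * k w) =
      \int[P]_(w in V @^-1` A) k w.
    rewrite [RHS]integral_mkcond; apply: eq_integral => w _.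
    rewrite patchE indicE.
    have -> : (w \in V @^-1` A) = (V w \in A) by apply/idP/idP; rewrite !inE.
    by case: ifP => _; rewrite ?mul1e ?mul0e.
  by rewrite !ind phipsi.
- move=> a f a0 mf f0; rewrite /Q => E.
  under eq_integral do rewrite -muleA.
  under [RHS]eq_integral do rewrite -muleA.
  rewrite !ge0_integralZl ?E //; first [by rewrite lee_fin | by move=> *; exact: mule_ge0
    | by apply: emeasurable_funM => //; exact: mcomp].
- move=> f g mf f0 mg g0; rewrite /Q => Ef Eg.
  under eq_integral do rewrite ge0_muleDl//.
  under [RHS]eq_integral do rewrite ge0_muleDl//.
  rewrite !ge0_integralD ?Ef ?Eg //; first [by move=> *; exact: mule_ge0
    | by apply: emeasurable_funM => //; exact: mcomp].
- move=> f_ mf f0 ndf; rewrite /Q => E.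
  have lims (k : T -> \bar R) (mk : measurable_fun [set: T] k) (k0y : forall w, 0 <= k w < +oo) :
      \int[P]_w (limn (f_ ^~ (V w)) * k w) =
      limn (fun n => \int[P]_w (f_ n (V w) * k w)).
    have k0 w : 0 <= k w by have /andP[] := k0y w.
    rewrite -monotone_convergence//.
    + apply: eq_integral => w _; rewrite limeMr//.
        by rewrite ge0_fin_numE//; have /andP[] := k0y w.
      exact: ereal_nondecreasing_is_cvgn.
    + by move=> n; apply: emeasurable_funM => //; exact: mcomp.
    + by move=> *; exact: mule_ge0.
    + by move=> w _ a b ab; apply: lee_wpmul2r => //; exact: ndf.
  rewrite !lims//; congr (limn _); apply/funext => n; exact: E.
Qed.

(** Two base measures make room for both uses: the Markov property, with [V] the later state and [U]
    the chain restarted from its state at time [s], and the invariance of [mu], with [V] the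
    identity. Measurability of the inner integral belongs to the same induction, since every step on
    the identity relies on it. *)
Lemma disintegration_ge0 d d' d1 d2 (T : measurableType d) (S : measurableType d')
    (T1 : measurableType d1) (O : measurableType d2)
    (n : {measure set T1 -> \bar R}) (V : {mfun T1 >-> S}) (B : set T1)
    (m : {measure set T -> \bar R}) (D : set T)
    (P : {measure set O -> \bar R}) (U : T -> {mfun O >-> S}) :
  measurable B -> measurable D ->
  (forall A, measurable A ->
     measurable_fun D (fun t => P (U t @^-1` A))) ->
  (forall A, measurable A ->
     n (B `&` V @^-1` A) = \int[m]_(t in D) P (U t @^-1` A)) ->
  forall g : S -> \bar R, measurable_fun [set: S] g -> (forall x, 0 <= g x) ->
  measurable_fun D (fun t => \int[P]_w g (U t w)) /\
  \int[n]_(w in B) g (V w) = \int[m]_(t in D) \int[P]_w g (U t w).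
Proof.
move=> mB mD mU nU g mg g0.
pose Q (g : S -> \bar R) :=
  measurable_fun D (fun t => \int[P]_w g (U t w)) /\
  \int[n]_(w in B) g (V w) = \int[m]_(t in D) \int[P]_w g (U t w).
have mV (k : S -> \bar R) : measurable_fun [set: S] k ->
    measurable_fun B (k \o V).
  by move=> mk; apply: (measurable_funS measurableT) => //; exact: measurableT_comp.
have mUt t (k : S -> \bar R) : measurable_fun [set: S] k ->
    measurable_fun [set: O] (k \o U t) by move=> mk; exact: measurableT_comp.
apply: (@ge0_measurable_fun_ind _ S R Q _ _ _ _ g mg g0) => {g mg g0}.
- move=> A mA.
  have E t : \int[P]_w (\1_A (U t w))%:E = P (U t @^-1` A).
    rewrite -[U t @^-1` A]setIT -integral_indic//.
      by rewrite -[X in measurable X]setTI; exact: measurable_funP.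
  split; first by under eq_fun do rewrite E; exact: mU.
  under [RHS]eq_integral do rewrite E.
  rewrite -nU// setIC -integral_indic//.
  by rewrite -[X in measurable X]setTI; exact: measurable_funP.
- move=> a f a0 mf f0 [mfU E].
  have Ea t : \int[P]_w (a%:E * f (U t w)) = a%:E * \int[P]_w f (U t w).
    by rewrite ge0_integralZl_EFin//; exact: mUt.
  split.
    under eq_fun do rewrite Ea; exact: measurable_funeM.
  under [RHS]eq_integral do rewrite Ea.
  rewrite !ge0_integralZl_EFin ?E//.
    by move=> *; exact: integral_ge0.
  exact: mV.
- move=> f g mf f0 mg g0 [mfU Ef] [mgU Eg].
  have E t : \int[P]_w (f (U t w) + g (U t w)) =
      \int[P]_w f (U t w) + \int[P]_w g (U t w).
    by rewrite ge0_integralD//; exact: mUt.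
  split; first by under eq_fun do rewrite E; exact: emeasurable_funD.
  under [RHS]eq_integral do rewrite E.
  transitivity (\int[n]_(w in B) f (V w) + \int[n]_(w in B) g (V w)).
    by apply: ge0_integralD => //; exact: mV.
  rewrite Ef Eg; apply/esym/ge0_integralD => //; by move=> *; exact: integral_ge0.
- move=> f_ mf f0 ndf Qf.
  have E t : \int[P]_w limn (f_ ^~ (U t w)) =
      limn (fun k => \int[P]_w f_ k (U t w)).
    by apply: monotone_convergence => // k; exact: mUt.
  have nd t : nondecreasing_seq (fun k => \int[P]_w f_ k (U t w)).
    move=> a b ab; apply: ge0_le_integral => //; first exact: mUt.
      exact: mUt.
    by move=> w _; exact: ndf.
  split.
    apply: (emeasurable_fun_cvg (fun k t => \int[P]_w f_ k (U t w))).
      by move=> k; exact: (Qf k).1.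
    by move=> t _; rewrite E; exact: ereal_nondecreasing_is_cvgn.
  under [RHS]eq_integral do rewrite E.
  transitivity (limn (fun k => \int[n]_(w in B) f_ k (V w))).
    by apply: monotone_convergence => // k; exact: mV.
  transitivity (limn (fun k => \int[m]_(t in D) \int[P]_w f_ k (U t w))).
    by congr (limn _); apply/funext => k; exact: (Qf k).2.
  apply/esym/monotone_convergence => // [k|k t _].
    exact: (Qf k).1.
  exact: integral_ge0.
Qed.

End Disintegration.

(** * A strong law from summable covariances *)

Section StrongLaw.
Context {d : measure_display} {T : measurableType d} {R : realType}.

Lemma sqr_sum_le (m : nat) (a : nat -> R) (k : nat) :
  (\sum_(m <= i < m + k) a i) ^+ 2 <= k%:R * \sum_(m <= i < m + k) a i ^+ 2.
Proof.
elim: k => [|k IH]; first by rewrite addn0 !big_geq// expr0n mul0r.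
rewrite addnS !big_nat_recr ?leq_addr//=.
move: IH; set S := \sum_(m <= i < m + k) a i; set Q := \sum_(m <= i < _) _.
move=> IH; set x := a _.
have [k0|k0] := eqVneq k 0%N.
  by rewrite /S /Q k0 addn0 !big_geq// !add0r mul1r.
have kp : 0 < k%:R :> R by rewrite ltr0n lt0n.
(* Expand [(S - k x)^2 >= 0], insert [S^2 <= k Q] and divide by [k], whence the separate case
   [k = 0]. *)
have h : 2 * S * x <= Q + k%:R * x ^+ 2.
  have : 0 <= (S - k%:R * x) ^+ 2 by exact: sqr_ge0.
  move=> h1; rewrite -(ler_pM2l kp); nra.
rewrite -natr1; nra.
Qed.

(** A Borel-Cantelli argument in mean: the random series has a finite integral, hence converges
    almost everywhere, and the terms of a convergent series tend to 0. *)
Lemma ae_cvg0_of_sum (P : {measure set T -> \bar R}) (u : nat -> T -> R)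
    (b : nat -> R) (B : R) :
  (forall n, measurable_fun [set: T] (u n)) -> (forall n w, 0 <= u n w) ->
  (forall n, (\int[P]_w (u n w)%:E <= (b n)%:E)%E) ->
  (forall n, \sum_(0 <= i < n) b i <= B) ->
  {ae P, forall w, u n w @[n --> \oo] --> 0}.
Proof.
move=> mu u0 ub bB.
pose F w := (\sum_(0 <= n <oo) (u n w)%:E)%E.
have u0e n w : (0 <= (u n w)%:E)%E by rewrite lee_fin.
have mue n : measurable_fun [set: T] (fun w => (u n w)%:E) by exact/measurable_EFinP.
have intF : (\int[P]_w F w <= B%:E)%E.
  rewrite integral_nneseries//.
  apply: lime_le; first by apply: is_cvg_nneseries => n _ _; exact: integral_ge0.
  apply: nearW => n.
  apply: (@le_trans _ _ (\sum_(0 <= i < n) (b i)%:E)%E); first exact: lee_sum.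
  by rewrite sumEFin lee_fin.
have F0 w : (0 <= F w)%E by exact: nneseries_ge0.
have iF : P.-integrable [set: T] F.
  apply/integrableP; split; first exact: ge0_emeasurable_sum.
  under eq_integral do rewrite gee0_abs//.
  by rewrite (le_lt_trans intF)// ltry.
have := integrable_ae measurableT iF.
apply: filterS => w /(_ I) Fw.
apply: cvg_series_cvg_0.
apply: nondecreasing_is_cvgn.
  by apply/nondecreasing_seqP => n; rewrite /series/= big_nat_recr//= lerDl.
exists (fine (F w)) => _ [n _ <-].
rewrite -lee_fin fineK// /series/= -sumEFin.
by rewrite /F; apply: nneseries_lim_ge.
Qed.

Variable P : {measure set T -> \bar R}.

Lemma integrable_mul_sqr (f g : T -> R) :
  measurable_fun [set: T] f -> measurable_fun [set: T] g ->
  P.-integrable [set: T] (fun w => (f w ^+ 2)%:E) ->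
  P.-integrable [set: T] (fun w => (g w ^+ 2)%:E) ->
  P.-integrable [set: T] (fun w => (f w * g w)%:E).
Proof.
move=> mf mg i_f i_g.
apply: (le_integrable measurableT _ _ (integrableD measurableT i_f i_g)).
  by apply/measurable_EFinP; exact: measurable_funM.
move=> w _ /=; rewrite lee_fin normrM.
rewrite [leRHS]ger0_norm ?addr_ge0 ?sqr_ge0//.
rewrite -(real_normK (num_real (f w))) -(real_normK (num_real (g w))).
have := sqr_ge0 (`|f w| - `|g w|).
have := mulr_ge0 (normr_ge0 (f w)) (normr_ge0 (g w)); nra.
Qed.

Lemma integrable_sqr_sum (xi : nat -> T -> R) (s : seq nat) :
  (forall i, measurable_fun [set: T] (xi i)) ->
  (forall i, P.-integrable [set: T] (fun w => (xi i w ^+ 2)%:E)) ->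
  P.-integrable [set: T] (fun w => ((\sum_(i <- s) xi i w) ^+ 2)%:E).
Proof.
move=> mxi ixi; elim: s => [|i s IH].
  under eq_fun do rewrite big_nil expr0n; exact: integrable0.
have mS : measurable_fun [set: T] (fun w => \sum_(j <- s) xi j w).
  exact: measurable_sum.
have im := integrable_mul_sqr _ _ (mxi i) mS (ixi i) IH.
rewrite (_ : (fun w => _) = (fun w => (xi i w ^+ 2)%:E +
    ((xi i w * \sum_(j <- s) xi j w)%:E + (xi i w * \sum_(j <- s) xi j w)%:E +
     ((\sum_(j <- s) xi j w) ^+ 2)%:E))%E).
  apply: integrableD => //; apply: integrableD => //.
  exact: integrableD.
by apply/funext => w; rewrite big_cons -!EFinD; congr EFin; ring.
Qed.

Variables (xi : nat -> T -> R) (C B : R) (r : nat -> R).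
Hypothesis mxi : forall i, measurable_fun [set: T] (xi i).
Hypothesis xi2 : forall i, (\int[P]_w (xi i w ^+ 2)%:E <= C%:E)%E.
Hypothesis xicov : forall i k,
  `|\int[P]_w (xi i w * xi (i + k)%N w)| <= r k.
Hypothesis rB : forall n, \sum_(0 <= k < n) r k <= B.

Let ixi2 i : P.-integrable [set: T] (fun w => (xi i w ^+ 2)%:E).
Proof.
apply/integrableP; split; first by apply/measurable_EFinP; exact: measurable_funX.
under eq_integral do rewrite gee0_abs ?lee_fin ?sqr_ge0//.
by rewrite (le_lt_trans (xi2 i))// ltry.
Qed.

Let S n w := \sum_(0 <= i < n) xi i w.

Let mS n : measurable_fun [set: T] (S n).
Proof. exact: measurable_sum. Qed.

Let iS2 n : P.-integrable [set: T] (fun w => (S n w ^+ 2)%:E).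
Proof. exact: integrable_sqr_sum. Qed.

Let r0 k : 0 <= r k.
Proof. exact: le_trans (xicov 0 k). Qed.

Let cross n : \int[P]_w (S n w * xi n w) <= B.
Proof.
have H m : (m <= n)%N ->
    \int[P]_w (S m w * xi n w) <= \sum_(0 <= i < m) r (n - i)%N.
  elim: m => [|m IH] mn.
    rewrite big_geq// (_ : (fun w => _) = cst 0) ?Rintegral_cst ?mul0r//.
    by apply/funext => w; rewrite /S big_geq// mul0r.
  rewrite big_nat_recr//=.
  under eq_Rintegral do rewrite /S big_nat_recr//= mulrDl -/(S m _).
  rewrite RintegralD//; last 2 first.
  - exact: (integrable_mul_sqr _ _ (mS m) (mxi n)).
  - exact: integrable_mul_sqr.
  apply: lerD; first exact: IH (ltnW mn).
  by have := xicov m (n - m)%N; rewrite subnKC ?(ltnW mn)// => /ler_normlW.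
apply: (le_trans (H n (leqnn n))).
(* Reversal turns the lags [n - i] into [1, ..., n]; the bound by [n + 1] terms of [r] also counts
   the lag 0, whose term is nonnegative. *)
rewrite big_nat_rev/= add0n.
apply: (le_trans _ (rB n.+1)).
rewrite big_nat_recl//= -[leLHS]add0r lerD//.
by apply: ler_sum_nat => i /andP[_ ni]; rewrite subKn.
Qed.

(** Each [xi n] adds its own second moment, at most [C], and twice its covariance with the past, at
    most [B] because the lags are summable. The growth is thus linear, where Cauchy-Schwarz alone
    would give a quadratic one. *)
Lemma second_moment_sum n : \int[P]_w (S n w ^+ 2) <= n%:R * (C + 2 * B).
Proof.
elim: n => [|n IH].
  rewrite (_ : (fun w => _) = cst 0) ?Rintegral_cst ?mul0r//.
  by apply/funext => w; rewrite /S big_geq// expr0n.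
have -> : \int[P]_w (S n.+1 w ^+ 2) =
    \int[P]_w (S n w ^+ 2 + (2 * (S n w * xi n w) + xi n w ^+ 2)).
  by apply: eq_Rintegral => w _; rewrite /S big_nat_recr//=; ring.
have im : P.-integrable [set: T] (fun w => (S n w * xi n w)%:E).
  exact: integrable_mul_sqr.
have im2 : P.-integrable [set: T] (fun w => (2 * (S n w * xi n w))%:E).
  by under eq_fun do rewrite EFinM; exact: integrableZl.
have iSn := iS2 n; have ixn := ixi2 n.
have isum : P.-integrable [set: T]
    (fun w => (2 * (S n w * xi n w) + xi n w ^+ 2)%:E).
  by under eq_fun do rewrite EFinD; exact: integrableD.
rewrite !RintegralD// RintegralZl//.
have h : \int[P]_w (xi n w ^+ 2) <= C.
  by rewrite -lee_fin /Rintegral fineK ?xi2//; exact: integrable_fin_num.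
have := cross n; rewrite -natr1; nra.
Qed.

Lemma slln_of_cov :
  {ae P, forall w, n%:R^-1 * \sum_(i < n) xi i w @[n --> \oo] --> 0}.
Proof.
have C0 : 0 <= C.
  by rewrite -lee_fin (le_trans _ (xi2 0))// integral_ge0// => w _; rewrite lee_fin sqr_ge0.
have B0 : 0 <= B by have := rB 0; rewrite big_geq.
(* [Q m] collects the squares over the block from [m^2] to [(m + 1)^2], of length [2 m + 1]; through
   [sqr_sum_le] it controls every partial sum inside the block. [u n] is attached to [m = n + 1],
   which keeps the denominator nonzero. *)
pose Q m w := \sum_(m ^ 2 <= i < m ^ 2 + (2 * m + 1)) xi i w ^+ 2.
pose u n w := n.+1%:R ^- 4 * (S (n.+1 ^ 2) w ^+ 2 + (2 * n.+1 + 1)%:R * Q n.+1 w).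
have Q0 m w : 0 <= Q m w by apply: sumr_ge0 => i _; exact: sqr_ge0.
have mQ m : measurable_fun [set: T] (Q m).
  by apply: measurable_sum => i; exact: measurable_funX.
have u0 n w : 0 <= u n w.
  by rewrite mulr_ge0 ?invr_ge0 ?exprn_ge0// addr_ge0 ?sqr_ge0// mulr_ge0.
have mu n : measurable_fun [set: T] (u n).
  apply: measurable_funM => //; apply: measurable_funD; first exact: measurable_funX.
  exact: measurable_funM.
have iQ m : (\int[P]_w (Q m w)%:E <= ((2 * m + 1)%:R * C)%:E)%E.
  under eq_integral do rewrite -sumEFin.
  rewrite ge0_integral_sum//; last 2 first.
  - by move=> i; apply/measurable_EFinP; exact: measurable_funX.
  - by move=> i w _; rewrite lee_fin sqr_ge0.
  apply: (@le_trans _ _ (\sum_(m ^ 2 <= i < m ^ 2 + (2 * m + 1)) C%:E)%E).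
    exact: lee_sum.
  by rewrite sumEFin sumr_const_nat addKn mulr_natl.
(* After division by [m^4] the first term contributes [(C + 2 B) / m^2], and the second
   [(2 m + 1)^2 C / m^4], at most [9 C / m^2] since [2 m + 1 <= 3 m]. *)
pose K := (C + 2 * B) + 9 * C.
have iu n : (\int[P]_w (u n w)%:E <= (K * n.+1%:R ^- 2)%:E)%E.
  have -> : (\int[P]_w (u n w)%:E = (n.+1%:R ^- 4)%:E *
      (\int[P]_w (S (n.+1 ^ 2) w ^+ 2)%:E +
       (2 * n.+1 + 1)%:R%:E * \int[P]_w (Q n.+1 w)%:E))%E.
    transitivity (\int[P]_w ((n.+1%:R ^- 4)%:E * ((S (n.+1 ^ 2) w ^+ 2)%:E +
        (2 * n.+1 + 1)%:R%:E * (Q n.+1 w)%:E)))%E.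
      by apply: eq_integral.
    have h1 : measurable_fun [set: T] (fun w => (S (n.+1 ^ 2) w ^+ 2)%:E).
      by apply/measurable_EFinP; exact: measurable_funX.
    have h2 : measurable_fun [set: T] (fun w => (Q n.+1 w)%:E).
      exact/measurable_EFinP.
    have h3 : measurable_fun [set: T]
        (fun w => (2 * n.+1 + 1)%:R%:E * (Q n.+1 w)%:E)%E.
      exact: measurable_funeM.
    have q0 w : (0 <= (S (n.+1 ^ 2) w ^+ 2)%:E)%E by rewrite lee_fin sqr_ge0.
    have q1 w : (0 <= (2 * n.+1 + 1)%:R%:E * (Q n.+1 w)%:E)%E.
      by rewrite -EFinM lee_fin mulr_ge0.
    have c0 : 0 <= n.+1%:R ^- 4 :> R by rewrite invr_ge0 exprn_ge0.
    have mD := emeasurable_funD h1 h3.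
    have q2 w : (0 <= (Q n.+1 w)%:E)%E by rewrite lee_fin.
    have qD w : (0 <= (S (n.+1 ^ 2) w ^+ 2)%:E +
        (2 * n.+1 + 1)%:R%:E * (Q n.+1 w)%:E)%E by rewrite adde_ge0.
    by rewrite ge0_integralZl_EFin// ge0_integralD// ge0_integralZl_EFin.
  have -> : (\int[P]_w (S (n.+1 ^ 2) w ^+ 2)%:E =
      (\int[P]_w (S (n.+1 ^ 2) w ^+ 2))%:E)%E.
    by rewrite /Rintegral fineK//; exact: integrable_fin_num.
  set m := n.+1.
  apply: (@le_trans _ _ ((m%:R ^- 4)%:E * (((m ^ 2)%:R * (C + 2 * B))%:E +
       (2 * m + 1)%:R%:E * ((2 * m + 1)%:R * C)%:E))%E).
    apply: lee_wpmul2l; first by rewrite lee_fin invr_ge0 exprn_ge0.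
    apply: leeD; first by rewrite lee_fin second_moment_sum.
    by apply: lee_wpmul2l; first by rewrite lee_fin.
  rewrite -EFinM lee_fin.
  have mp : 0 < m%:R :> R by rewrite ltr0n.
  have m1 : 1 <= m%:R :> R by rewrite ler1n.
  rewrite -(ler_pM2l (exprn_gt0 4 mp)) mulrA divff ?expf_neq0 ?gt_eqF// mul1r.
  have -> : m%:R ^+ 4 * (K * m%:R ^- 2) = m%:R ^+ 2 * K.
    by field; rewrite gt_eqF.
  rewrite natrX natrD natrM /K; set x : R := m%:R in mp m1 *.
  have h : 0 <= (9 * x ^+ 2 - (2 * x + 1) ^+ 2) * C by rewrite mulr_ge0//; nra.
  nra.
have KB n : \sum_(0 <= i < n) (K * i.+1%:R ^- 2) <= K * 2.
  (* Telescoping: [1 / m^2 <= 2 / m - 2 / (m + 1)] holds as soon as [m >= 1]. *)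
  suff h : \sum_(0 <= i < n) (i.+1%:R ^- 2) <= 2 - 2 * n.+1%:R^-1 :> R.
    rewrite -mulr_sumr ler_wpM2l//.
      by rewrite /K; lra.
    by rewrite (le_trans h)// gerBl mulr_ge0.
  elim: n => [|n IH]; first by rewrite big_geq// invr1; lra.
  rewrite big_nat_recr//=; apply: (le_trans (lerD IH (lexx _))).
  have mp : 0 < n.+1%:R :> R by rewrite ltr0n.
  have mp1 : 1 <= n.+1%:R :> R by rewrite ler1n.
  rewrite -[n.+2%:R]natr1; set m : R := n.+1%:R in mp mp1 *.
  rewrite -subr_ge0.
  have -> : 2 - 2 / (m + 1) - (2 - 2 / m + m ^- 2) = (m - 1) / (m ^+ 2 * (m + 1)).
    by field; rewrite !gt_eqF//; lra.
  by rewrite divr_ge0 ?mulr_ge0 ?exprn_ge0//; lra.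
have := ae_cvg0_of_sum P u _ _ mu u0 iu KB.
apply: filterS => w uw.
have sq (k : nat) : exists m, (m ^ 2 <= k < m.+1 ^ 2)%N.
  elim: k => [|k [m /andP[mk km]]]; first by exists 0.
  have [h|h] := ltnP k.+1 (m.+1 ^ 2)%N.
    by exists m; rewrite h ltnW.
  exists m.+1; rewrite h /=; apply: (leq_ltn_trans km).
  by rewrite ltn_exp2r.
apply/cvgrPdist_lt => e e0.
(* Cutting [S k] at [m^2] costs a factor 2 in the squares:
   [(S k)^2 <= 2 m^4 u < e^2 m^4 <= e^2 k^2]. *)
have e2 : 0 < e ^+ 2 / 2 by rewrite divr_gt0// exprn_gt0.
move/cvgrPdist_lt/(_ _ e2) : uw => [N _ Nu].
exists (N.+1 ^ 2)%N => // k /= Nk.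
have [m /andP[mk km]] := sq k.
have Nm : (N < m)%N.
  have := leq_ltn_trans Nk km; rewrite ltn_exp2r//.
case: m mk km Nm => // n mk km Nn.
have := Nu n Nn; rewrite /= sub0r normrN ger0_norm// => une.
have kp : 0 < k%:R :> R by rewrite ltr0n (leq_trans _ mk)// expn_gt0.
have -> : \sum_(i < k) xi i w = S k w by rewrite /S big_mkord.
rewrite sub0r normrN -(ltr_pXn2r (_ : 0 < 2)%N) ?nnegrE ?normr_ge0 ?(ltW e0)//.
rewrite real_normK ?num_real// exprMn.
set m := n.+1 in mk km une *.
have Sk : S k w ^+ 2 <= 2 * (S (m ^ 2) w ^+ 2 + (2 * m + 1)%:R * Q m w).
  have -> : S k w = S (m ^ 2) w + \sum_(m ^ 2 <= i < k) xi i w.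
    by rewrite /S -big_cat_nat.
  set D := \sum_(m ^ 2 <= i < k) xi i w.
  have DQ : D ^+ 2 <= (2 * m + 1)%:R * Q m w.
    have km2 : (k - m ^ 2 <= 2 * m + 1)%N.
      by rewrite leq_subLR -ltnS (leq_trans km)// -addn1 sqrnD; lia.
    have := sqr_sum_le (m ^ 2) (xi ^~ w) (k - m ^ 2).
    rewrite subnKC// => /le_trans; apply; apply: ler_pM => //.
    - by apply: sumr_ge0 => i _; exact: sqr_ge0.
    - by rewrite ler_nat.
    - rewrite /Q (@big_cat_nat _ _ _ k (m ^ 2) (m ^ 2 + _))//=; last by lia.
      by rewrite lerDl sumr_ge0// => i _; exact: sqr_ge0.
  have := sqr_ge0 (S (m ^ 2) w - D); nra.
have mp : 0 < m%:R :> R by rewrite ltr0n.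
have mk2 : m%:R ^+ 4 <= k%:R ^+ 2 :> R.
  by rewrite (exprM _ 2 2) -natrX lerXn2r ?nnegrE ?ler_nat.
rewrite exprVn mulrC ltr_pdivrMr ?exprn_gt0//.
apply: (le_lt_trans Sk).
move: une; rewrite /u -/m mulrC ltr_pdivrMr ?exprn_gt0// => une.
have := sqr_ge0 e; nra.
Qed.

End StrongLaw.

(** * Inequalities for the semimetric d_{p,gamma} *)

Section ScalarInequalities.
Context {R : realType}.

Lemma powR_le1D (t a b : R) : 0 <= t -> 0 <= a <= b -> t `^ a <= 1 + t `^ b.
Proof.
move=> t0 /andP[a0 ab]; have [t1|t1] := leP t 1.
  rewrite -[leLHS]addr0 lerD ?powR_ge0//.
  by have := @ge0_ler_powR _ _ a0 t 1; rewrite !nnegrE powR1; apply.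
by rewrite -[leLHS]add0r lerD// ler_powR// ltW.
Qed.

Lemma min1_powR_le (s a b : R) : 0 <= s -> 0 < b <= a ->
  Num.min 1 (s `^ a) <= s `^ b.
Proof.
move=> s0 /andP[b0 ba]; rewrite ge_min; have [s1|s1] := leP s 1; last first.
  by have := @ge0_ler_powR _ _ (ltW b0) 1 s; rewrite !nnegrE powR1 ler01 => -> //; exact: ltW.
apply/orP; right; move: s0; rewrite le_eqVlt => /predU1P[<-|s0].
  by rewrite !powR0 ?gt_eqF// (lt_le_trans b0).
by rewrite ger_powR// s0.
Qed.

Lemma powR_scale (t m p q : R) : 0 <= t -> 0 < m -> 0 <= p <= q ->
  t `^ p <= m `^ p * (1 + t `^ q / m `^ q).
Proof.
move=> t0 m0 pq.
have {1}-> : t = m * (t / m) by rewrite mulrCA divff ?gt_eqF// mulr1.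
have tm0 : 0 <= t / m by rewrite divr_ge0// ltW.
have m0' := ltW m0.
rewrite powRM// ler_wpM2l ?powR_ge0//.
apply: (le_trans (powR_le1D _ _ _ tm0 pq)); rewrite lerD2l.
by rewrite powRM ?invr_ge0// -[X in _ * X `^ q]powR_inv1// -powRrM mulN1r powRN.
Qed.

Lemma eq0_le_powR (c k b : R) : 0 < b ->
  (forall eta : R, 0 < eta -> c <= eta `^ b * k) -> c <= 0.
Proof.
move=> b0 H; rewrite leNgt; apply/negP => c0.
have k0 : 0 < k.
  have := H 1 ltr01; rewrite powR1 mul1r; exact: lt_le_trans.
(* If [eta^b] equals this [x], the hypothesis reads [c <= c / 2]. *)
pose x := c / k / 2.
have x0 : 0 < x by rewrite !divr_gt0.
have x0' := ltW x0.
have := H (x `^ b^-1); rewrite -powRrM mulVf ?gt_eqF// powRr1//.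
have -> : x * k = c / 2 by rewrite /x; field; rewrite gt_eqF.
rewrite powR_gt0// => /(_ isT); lra.
Qed.

(** Beyond the level, [N (|c| - N) <= c^2]. A common bound on second moments therefore makes the
    truncation error [O(1 / N)] uniformly over a family, which takes the place of uniform
    integrability. *)
Lemma trunc_error (N c : R) : 0 < N ->
  `|c - Num.min N (Num.max (- N) c)| <= N^-1 * c ^+ 2.
Proof.
move=> N0; rewrite -(ler_pM2l N0) mulVKf ?gt_eqF//.
have h0 := sqr_ge0 c.
rewrite /Order.max /Order.min; case: (ltP (- N) c) => h1; case: ltP => h2.
- by rewrite ger0_norm; nra.
- by rewrite subrr normr0 mulr0.
- by lra.
- by rewrite ler0_norm; nra.
Qed.

Lemma norm_trunc (N c : R) : 0 <= N -> `|Num.min N (Num.max (- N) c)| = Num.min N `|c|.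
Proof.
move=> N0; have [c0|c0] := leP 0 c.
  rewrite (ger0_norm c0); rewrite max_r; last by lra.
  by rewrite ger0_norm// le_min N0.
rewrite (ltr0_norm c0) min_r; last by rewrite ge_max; lra.
rewrite /Order.max /Order.min.
by case: ltP => h1; case: ltP => h2; rewrite ler0_norm; lra.
Qed.

Context {E : completeNormedModType R}.

(* AM-GM for [t ^ b * sqrt W] with [t = `|u - v| / dl]; it replaces the
   Cauchy-Schwarz and Jensen inequalities once expectations are taken. *)
Lemma dpg_le (p gamma b dl : R) (u v : E) :
  0 < b <= gamma -> gamma <= 1 -> 0 < dl ->
  dpg p gamma u v <=
  dl `^ b / 2 * (2 + (`|u - v| / dl) ^+ 2 + `|u| `^ p + `|v| `^ p).
Proof.
move=> bg g1 dl0; have /andP[b0 bg'] := bg.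
rewrite /dpg; set s := `|u - v|; set W := 1 + `|u| `^ p + `|v| `^ p.
have W0 : 0 <= W by rewrite !addr_ge0 ?powR_ge0.
have s0 : 0 <= s by exact: normr_ge0.
pose t := s / dl.
have t0 : 0 <= t by rewrite divr_ge0// ltW.
have -> : (s / dl) ^+ 2 = t ^+ 2 by [].
have sE : s = dl * t by rewrite /t mulrCA divff ?gt_eqF// mulr1.
apply: (@le_trans _ _ (dl `^ b * (t `^ b * Num.sqrt W))).
  rewrite mulrA -powRM// ?(ltW dl0)// -sE ler_wpM2r ?sqrtr_ge0//.
  exact: min1_powR_le.
rewrite -mulrA ler_wpM2l ?powR_ge0//.
have h1 : (t `^ b) ^+ 2 <= 1 + t ^+ 2.
  rewrite -powR_mulrn ?powR_ge0// -powRrM -(powR_mulrn 2 t0).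
  apply: powR_le1D => //; apply/andP; split; first by rewrite mulr_ge0// ltW.
  by rewrite -[leRHS]mul1r ler_wpM2r// (le_trans bg').
have h2 := sqr_sqrtr W0; have h3 := sqr_ge0 (t `^ b - Num.sqrt W).
rewrite /W in h2 *; nra.
Qed.

(** Both suprema are nonnegative, so finiteness of their sum makes each of them finite; the sum of
    their values then serves as a common constant. *)
Lemma Cpg_bounds (p gamma : R) (f : E -> R) : 0 < gamma -> Cpg p gamma f ->
  exists2 K : R, 0 <= K &
  (forall u, `|f u| <= K * (1 + `|u| `^ (p / 2))) /\
  (forall u v, `|f u - f v| <= K * dpg p gamma u v).
Proof.
move=> g0 [_]; rewrite /norm_pg.
set S1 := ereal_sup _; set S2 := ereal_sup _ => S12.
have d0 (u v : E) : 0 <= dpg p gamma u v.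
  by rewrite mulr_ge0 ?sqrtr_ge0// le_min ler01 powR_ge0.
have S1u u : ((`|f u| / (1 + `|u| `^ (p / 2)))%:E <= S1)%E.
  by apply: ereal_sup_ubound; exists u.
have S2u u v : ((`|f u - f v| / dpg p gamma u v)%:E <= S2)%E.
  by apply: ereal_sup_ubound; exists (u, v).
have S10 : (0 <= S1)%E.
  apply: le_trans (S1u 0); rewrite lee_fin divr_ge0// addr_ge0// powR_ge0.
have S20 : (0 <= S2)%E by apply: le_trans (S2u 0 0); rewrite lee_fin divr_ge0.
have S1f : S1 \is a fin_num.
  by rewrite ge0_fin_numE//; apply: le_lt_trans S12; rewrite leeDl.
have S2f : S2 \is a fin_num.
  by rewrite ge0_fin_numE//; apply: le_lt_trans S12; rewrite leeDr.
exists (fine S1 + fine S2); first by rewrite addr_ge0// fine_ge0.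
split=> [u|u v].
  have := S1u u; rewrite -(fineK S1f) lee_fin ler_pdivrMr; last first.
    by rewrite ltr_wpDr ?powR_ge0.
  move/le_trans; apply; rewrite ler_wpM2r ?addr_ge0 ?powR_ge0//.
  by rewrite lerDl fine_ge0.
have [->|uv] := eqVneq u v; first by rewrite subrr normr0 mulr_ge0// addr_ge0// fine_ge0.
have dp : 0 < dpg p gamma u v.
  rewrite mulr_gt0 ?sqrtr_gt0 ?ltr_wpDr ?powR_ge0//.
  by rewrite lt_min ltr01 powR_gt0// normr_gt0 subr_eq0.
have := S2u u v; rewrite -(fineK S2f) lee_fin ler_pdivrMr//.
by move/le_trans; apply; rewrite ler_wpM2r// lerDr fine_ge0.
Qed.

(** Clamping is 1-Lipschitz, so all truncations of [f] share the constant [K]. *)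
Lemma min_dpg_contract (K p gamma N : R) (f : E -> R) :
  (forall u v, `|f u - f v| <= K * dpg p gamma u v) ->
  forall u v, `|Num.min N (Num.max (- N) (f u)) - Num.min N (Num.max (- N) (f v))|
    <= K * dpg p gamma u v.
Proof.
move=> H u v; apply: le_trans (H u v).
have h1 := ler_norm (f u - f v); have h2 := ler_norm (f v - f u).
rewrite distrC in h2; rewrite ler_norml.
move: h1 h2; set D := `|_|; move: (f u) (f v) => a b h1 h2.
rewrite /Order.max /Order.min.
case: (ltP (- N) a) => ha; case: (ltP (- N) b) => hb;
  (case: ltP => h3; case: ltP => h4; try (apply/andP; split; lra)).
Qed.

End ScalarInequalities.

(** * Random variables in a separable Banach space *)

Section BanachRandomVariables.
Context {R : realType} {E : completeNormedModType R}.

Lemma continuous_borel_measurable (f : E -> R) : continuous f ->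
  measurable_fun [set: borel E] (f : borel E -> R).
Proof.
move=> cf; apply: (measurability _ (RGenOpens.measurableE R)).
move=> _ [_ [a [b ->] <-]]; rewrite setTI; apply: sub_sigma_algebra.
by move/continuousP : cf; apply; exact: interval_open.
Qed.

(** The span is a countable union of images of the cubes [[-k, k]^n] under a continuous map; each
    image is compact, hence closed. *)
Lemma finite_dim_subspace_measurable (S : set E) : finite_dim_subspace S ->
  measurable (S : set (borel E)).
Proof.
move=> [n [e ->]].
pose g (v : 'rV[R]_n) : E := \sum_(i < n) v ord0 i *: e i.
have cg : continuous g.
  apply: (continuous_big (op := +%R)); first exact: add_continuous.
  move=> i _ v; apply: (@cvgZr_tmp _ _ _ (nbhs v) (nbhs_filter v)); exact: (@coord_continuous R 1 n ord0 i v).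
rewrite (_ : [set _ | _ in _] =
    \bigcup_k (g @` [set v : 'rV[R]_n | forall i, `[- k%:R, k%:R]%classic (v ord0 i)])).
  apply: bigcupT_measurable => k.
  rewrite -[X in measurable X]setCK; apply: measurableC; apply: sub_sigma_algebra.
  rewrite openC; apply: compact_closed; first exact: norm_hausdorff.
  apply: continuous_compact; first exact: continuous_subspaceT.
  exact: (@rV_compact R n (fun=> `[- k%:R, k%:R]%classic) (fun=> @segment_compact R _ _)).
apply/seteqP; split=> [_ [c _ <-]|_ [k _ [v _ <-]]]; last first.
  by exists (v ord0).
pose M := \sum_(i < n) `|c i|.
exists (Num.truncn M).+1 => //; exists (\row_i c i); last first.
  by apply: eq_bigr => i _; rewrite mxE.
move=> i /=; rewrite mxE in_itv/= -ler_norml.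
apply: ltW; apply: le_lt_trans (truncnS_gt _).
by rewrite /M (bigD1 i)//= lerDl sumr_ge0.
Qed.

Context {d : measure_display} {Omega : measurableType d}.

(** Without separability the pair [(U, V)] need not be Borel measurable in the product space. A
    countable dense set of centres gets around this: [|U - V| < x] holds exactly when
    [|U - c| + |V - c| < x] for some centre [c], any [c] within half the slack of [U] being a
    witness. *)
Lemma measurable_dist (U V : {mfun Omega >-> borel E}) : separable E ->
  measurable_fun [set: Omega] (fun w => `|(U w : E) - V w|).
Proof.
move=> [D [cD dD]].
have mU (W : {mfun Omega >-> borel E}) (c : E) : measurable_fun [set: Omega] (fun w => `|(W w : E) - c|).
  apply: (measurableT_comp (f := fun u : borel E => `|(u : E) - c|)) => //.
  apply: continuous_borel_measurable => u.
  by apply: cvg_norm; apply: cvgB; [exact: cvg_id|exact: cvg_cst].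
apply: (measurability _ (RGenInftyO.measurableE R)) => _ [_ [x ->] <-]; rewrite setTI.
rewrite (_ : _ @^-1` _ = \bigcup_(c in D)
    [set w | `|(U w : E) - c| + `|(V w : E) - c| < x]); last first.
  apply/seteqP; split=> [w|w [c _]] /=; rewrite in_itv/=; last first.
    by apply: le_lt_trans; rewrite (distrC (V w : E) c); exact: ler_distD.
  move=> UVx; pose e := (x - `|(U w : E) - V w|) / 2.
  have e0 : 0 < e by rewrite divr_gt0// subr_gt0.
  have [c [cb Dc]] := dD (ball (U w : E) e) (ex_intro _ (U w : E) (ballxx _ e0)) (ball_open _ _).
  exists c => //=; move: cb; rewrite -ball_normE/= => cb.
  have : `|(V w : E) - c| <= `|(U w : E) - V w| + `|(U w : E) - c|.
    by rewrite (distrC (U w : E) (V w : E)); exact: ler_distD.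
  by rewrite /e in cb; lra.
rewrite bigcup_set_type; apply: countable_bigcupT_measurable.
  by rewrite (eq_countable (card_setT D)).
move=> c; rewrite -[X in measurable X]setTI.
have mS := measurable_funD (mU U (val c)) (mU V (val c)).
have := mS measurableT `]-oo, x[%classic (measurable_itv _).
by congr (measurable _); apply/seteqP; split=> w /=; rewrite in_itv.
Qed.

Lemma measurable_normpowR (U : {mfun Omega >-> borel E}) (p : R) :
  measurable_fun [set: Omega] (fun w => `|U w : E| `^ p).
Proof.
apply: (measurableT_comp (f := @powR R ^~ p)); first exact: measurable_powR.
apply: (measurableT_comp (f := fun u : borel E => `|u : E|)) => //.
by apply: continuous_borel_measurable => u; exact: norm_continuous.
Qed.

Context (P : probability Omega R).

Lemma integral_prob_cst (c : \bar R) : (\int[P]_(_ in [set: Omega]) c = c)%E.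
Proof. by rewrite integral_cst// [X in (_ * X)%E](probability_setT P) mule1. Qed.

Lemma momentE r (U : {mfun Omega >-> borel E}) :
  moment P r U = (\int[P]_w (`|U w : E| `^ r)%:E)%E.
Proof. by rewrite /moment unlock. Qed.

(** Jensen's inequality up to the factor 2. At the scale [m] with [m^q = M], [powR_scale] bounds
    [|U|^p] by [m^p (1 + |U|^q / M)], and the bracket has mean at most 2. *)
Lemma le_moment_interp (p q M : R) (U : {mfun Omega >-> borel E}) :
  0 < p <= q -> 0 < M -> (moment P q U <= M%:E)%E ->
  (moment P p U <= (2 * M `^ (p / q))%:E)%E.
Proof.
move=> /andP[p0 pq] M0; rewrite !momentE => UM.
have q0 : 0 < q by exact: lt_le_trans pq.
pose m := M `^ q^-1; have m0 : 0 < m by rewrite powR_gt0.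
have mq : m `^ q = M by rewrite -powRrM mulVf ?gt_eqF// powRr1// ltW.
have mp : m `^ p = M `^ (p / q) by rewrite -powRrM mulrC.
have mU r : measurable_fun [set: Omega] (fun w => (`|U w : E| `^ r)%:E).
  by apply/measurable_EFinP; exact: measurable_normpowR.
apply: (@le_trans _ _ (\int[P]_w ((m `^ p)%:E * (1 + M^-1%:E * (`|U w : E| `^ q)%:E)))%E).
  apply: ge0_le_integral => //.
  - by apply: measurable_funeM; apply: emeasurable_funD => //; exact: measurable_funeM.
  - move=> w _; rewrite -EFinM lee_fin -mq [_^-1 * _]mulrC; apply: powR_scale => //.
    by rewrite pq ltW.
have h0 w : (0 <= (`|U w : E| `^ q)%:E)%E by rewrite lee_fin powR_ge0.
have Mi0 : 0 <= M^-1 by rewrite invr_ge0 ltW.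
have h1 w : (0 <= M^-1%:E * (`|U w : E| `^ q)%:E)%E by rewrite mule_ge0.
have h2 w : (0 <= 1 + M^-1%:E * (`|U w : E| `^ q)%:E)%E by rewrite adde_ge0.
have m1 := measurable_funeM M^-1%:E (mU q).
have m2 : measurable_fun [set: Omega] (fun w => (1 + M^-1%:E * (`|U w : E| `^ q)%:E))%E.
  exact: emeasurable_funD.
rewrite ge0_integralZl_EFin ?powR_ge0// ge0_integralD// integral_prob_cst.
rewrite ge0_integralZl_EFin// -mp mulrC EFinM.
apply: lee_wpmul2l; first by rewrite lee_fin powR_ge0.
apply: (@le_trans _ _ (1 + M^-1%:E * M%:E)%E); first by rewrite leeD2l// lee_wpmul2l.
by rewrite -EFinM mulVf ?gt_eqF.
Qed.

Lemma L2dist_sqr (U V : {mfun Omega >-> borel E}) (dl : R) : 0 <= dl ->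
  (L2dist P U V <= dl%:E)%E ->
  (\int[P]_w (`|(U w : E) - V w| ^+ 2)%:E <= (dl ^+ 2)%:E)%E.
Proof.
move=> dl0 UV.
have n2 : (2:R) != 0 by rewrite pnatr_eq0.
have -> : (\int[P]_w (`|(U w : E) - V w| ^+ 2)%:E = L2dist P U V `^ 2)%E.
  rewrite /L2dist powR_Lnorm//; apply: eq_integral => w _.
  by rewrite gee0_abs// poweR_EFin powR_mulrn.
rewrite -(powR_mulrn 2 dl0) -poweR_EFin.
by apply: gt0_ler_poweR => //; rewrite in_itv/= leey andbT// Lnorm_ge0.
Qed.

(** Average [dpg_le] at the scale [dl]: the normalised squared distance contributes at most 1, which
    together with the 2 already present in [dpg_le] makes the constant 3. *)
Lemma dist_expectation_le (g : E -> R) (K p gamma b dl a1 a2 : R)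
    (U V : {mfun Omega >-> borel E}) :
  separable E -> continuous g -> 0 <= K ->
  (forall u v, `|g u - g v| <= K * dpg p gamma u v) ->
  0 < b <= gamma -> gamma <= 1 -> 0 <= dl ->
  (L2dist P U V <= dl%:E)%E ->
  (moment P p U <= a1%:E)%E -> (moment P p V <= a2%:E)%E ->
  (\int[P]_w `|g (U w) - g (V w)|%:E <= (K * (dl `^ b / 2) * (3 + a1 + a2))%:E)%E.
Proof.
move=> sepE cg K0 gK bg g1 dl0 UV Ua1 Va2.
have mgU (W : {mfun Omega >-> borel E}) : measurable_fun [set: Omega] (fun w => g (W w)).
  exact: (measurableT_comp (continuous_borel_measurable _ cg)).
have mLHS : measurable_fun [set: Omega] (fun w => `|g (U w) - g (V w)|%:E).
  apply/measurable_EFinP; apply: measurableT_comp => //; exact: measurable_funB.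
have step (eta : R) : 0 < eta -> (L2dist P U V <= eta%:E)%E ->
    (\int[P]_w `|g (U w) - g (V w)|%:E <= (K * (eta `^ b / 2) * (3 + a1 + a2))%:E)%E.
  move=> eta0 UVeta; set c := K * (eta `^ b / 2).
  have c0 : 0 <= c by rewrite !mulr_ge0 ?powR_ge0.
  pose h1 (w : Omega) : \bar R := (2:R)%:E.
  pose h2 w := ((eta ^- 2)%:E * (`|(U w : E) - V w| ^+ 2)%:E)%E.
  pose h3 w := (`|U w : E| `^ p)%:E; pose h4 w := (`|V w : E| `^ p)%:E.
  have e0 : 0 <= eta ^- 2 by rewrite invr_ge0 exprn_ge0// ltW.
  have h10 w : (0 <= h1 w)%E by rewrite lee_fin.
  have s0 w : (0 <= (`|(U w : E) - V w| ^+ 2)%:E)%E by rewrite lee_fin exprn_ge0.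
  have h20 w : (0 <= h2 w)%E by rewrite mule_ge0.
  have h30 w : (0 <= h3 w)%E by rewrite lee_fin powR_ge0.
  have h40 w : (0 <= h4 w)%E by rewrite lee_fin powR_ge0.
  have ms : measurable_fun [set: Omega] (fun w => (`|(U w : E) - V w| ^+ 2)%:E).
    by apply/measurable_EFinP/measurable_funX; exact: measurable_dist.
  have m1 : measurable_fun [set: Omega] h1 by exact: measurable_cst.
  have m2 : measurable_fun [set: Omega] h2 by exact: measurable_funeM.
  have m3 : measurable_fun [set: Omega] h3 by exact/measurable_EFinP/measurable_normpowR.
  have m4 : measurable_fun [set: Omega] h4 by exact/measurable_EFinP/measurable_normpowR.
  have m12 : measurable_fun [set: Omega] (fun w => h1 w + h2 w)%E by exact: emeasurable_funD.
  have m123 : measurable_fun [set: Omega] (fun w => h1 w + h2 w + h3 w)%E by exact: emeasurable_funD.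
  have m1234 : measurable_fun [set: Omega] (fun w => h1 w + h2 w + h3 w + h4 w)%E by exact: emeasurable_funD.
  have h120 w : (0 <= h1 w + h2 w)%E by rewrite adde_ge0.
  have h1230 w : (0 <= h1 w + h2 w + h3 w)%E by rewrite adde_ge0.
  have h12340 w : (0 <= h1 w + h2 w + h3 w + h4 w)%E by rewrite adde_ge0.
  apply: (@le_trans _ _ (\int[P]_w (c%:E * (h1 w + h2 w + h3 w + h4 w)))%E).
    apply: ge0_le_integral => //; first exact: measurable_funeM.
    move=> w _; rewrite (_ : (c%:E * _)%E = (c * (2 + eta ^- 2 *
      `|(U w : E) - V w| ^+ 2 + `|U w : E| `^ p + `|V w : E| `^ p))%:E)// lee_fin.
    apply: (le_trans (gK _ _)); rewrite /c -mulrA ler_wpM2l//.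
    by have := dpg_le p gamma b eta (U w) (V w) bg g1 eta0; rewrite expr_div_n [_ / eta ^+ 2]mulrC.
  rewrite ge0_integralZl_EFin// [X in (_ <= X)%E]EFinM; apply: lee_wpmul2l; first by rewrite lee_fin.
  rewrite !ge0_integralD//.
  have -> : 3 + a1 + a2 = 2 + 1 + a1 + a2 by lra.
  rewrite !EFinD; apply: leeD; last by rewrite -momentE.
  apply: leeD; last by rewrite -momentE.
  apply: leeD; first by rewrite integral_prob_cst.
  rewrite ge0_integralZl_EFin//.
  apply: (@le_trans _ _ ((eta ^- 2)%:E * (eta ^+ 2)%:E)%E).
    apply: lee_wpmul2l; first by rewrite lee_fin.
    by apply: L2dist_sqr => //; exact: ltW.
  by rewrite -EFinM mulVf// expf_neq0// gt_eqF.
have [dlp|dln] := ltP 0 dl; first exact: step.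
(* Dividing by [dl] is impossible here; the estimate holds at every scale [eta > 0] instead, and
   [eta^b] tends to 0. *)
have {dln dl0}dlE : dl = 0 by apply/eqP; rewrite eq_le dln.
have b0 : 0 < b by case/andP: bg.
rewrite dlE powR0 ?(gt_eqF b0)//.
rewrite mul0r mulr0 mul0r.
set I := (\int[P]_w _)%E.
have I0 : (0 <= I)%E by apply: integral_ge0 => w _; rewrite lee_fin.
have Ifin : I \is a fin_num.
  rewrite ge0_fin_numE//; apply: le_lt_trans (step 1 ltr01 _) _; last exact: ltry.
  by apply: (le_trans UV); rewrite dlE lee_fin.
rewrite -(fineK Ifin) lee_fin.
apply: (@eq0_le_powR _ _ (K / 2 * (3 + a1 + a2)) b b0).
move=> eta eta0; rewrite -lee_fin fineK//.
apply: le_trans (step eta eta0 _) _.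
  by apply: (le_trans UV); rewrite dlE lee_fin ltW.
by rewrite lee_fin le_eqVlt; apply/orP; left; apply/eqP; field.
Qed.

End BanachRandomVariables.

(** * The Markov property for unbounded functions *)

Section MarkovIdentity.
Context {R : realType} {E : completeNormedModType R}.
Context {d : measure_display} {Omega : measurableType d} (P : probability Omega R).
Context (S : set E) (Y : E -> nat -> {mfun Omega >-> borel E}).
Hypothesis mS : measurable (S : set (borel E)).
Hypothesis chainY : markov_chain P S Y.
Context (x : E) (s t : nat).
Hypothesis Sx : S x.

Let Yst w : E := Y x (s + t)%N w.
Let Ys w : E := Y x s w.
Let mean (f : E -> R) (y : E) := \int[P]_w f (Y y t w).

Let SYs w : S (Ys w).
Proof. exact: (markov_state chainY). Qed.

(** The event that [Ys] lies in [A] belongs to the natural filtration at time [s], so the Markov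
    property applies to it. The transition kernel is measurable on [S] only; composing it with [Ys],
    which stays in [S], gives measurability on all of [Omega]. *)
Lemma markov_ge0 (g : E -> \bar R) :
  measurable_fun [set: borel E] (g : borel E -> \bar R) ->
  (forall y, 0 <= g y)%E ->
  measurable_fun [set: Omega] (fun w => \int[P]_w' g (Y (Ys w) t w'))%E /\
  (forall A : set (borel E), measurable A ->
    \int[P]_(w in Ys @^-1` A) g (Yst w) =
    \int[P]_(w in Ys @^-1` A) \int[P]_w' g (Y (Ys w) t w'))%E.
Proof.
move=> mg g0.
have mYs (A : set (borel E)) : measurable A -> measurable (Ys @^-1` A).
  by move=> mA; rewrite -[X in measurable X]setTI; exact: measurable_funP.
have mker (B : set (borel E)) : measurable B ->
    measurable_fun [set: Omega] (fun w => P (Y (Ys w) t @^-1` B)).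
  move=> mB; apply: (measurable_comp (F := S : set (borel E))
    (f := fun y : borel E => P (Y y t @^-1` B)) (g := Ys : Omega -> borel E)) => //.
  - by move=> _ [w _ <-].
  - by apply: (markov_kernel chainY).
have H (A : set (borel E)) : measurable A ->
  measurable_fun (Ys @^-1` A) (fun w => \int[P]_w' g (Y (Ys w) t w'))%E /\
    (\int[P]_(w in Ys @^-1` A) g (Yst w) =
    \int[P]_(w in Ys @^-1` A) \int[P]_w' g (Y (Ys w) t w'))%E.
  move=> mA.
  apply: (@disintegration_ge0 R _ _ _ _ Omega (borel E) Omega Omega P (Y x (s + t)%N)
    (Ys @^-1` A) P (Ys @^-1` A) P (fun w => Y (Ys w) t)) => //.
  - exact: mYs.
  - exact: mYs.
  - by move=> B mB; apply: measurable_funTS; exact: mker.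
  - move=> B mB; apply: (markov_property chainY) => //.
    by apply: sub_sigma_algebra; exists s, A.
split; last by move=> A mA; exact: (H A mA).2.
by have := (H setT measurableT).1; rewrite preimage_setT.
Qed.

(** Integrability accompanies the equality so that two instances can be subtracted. *)
Let identity (h f : E -> R) :=
  P.-integrable [set: Omega] (fun w => (h (Ys w) * mean f (Ys w))%:E) /\
  \int[P]_w (h (Ys w) * f (Yst w)) = \int[P]_w (h (Ys w) * mean f (Ys w)).

Let bmeas (f : E -> R) := measurable_fun [set: borel E] (f : borel E -> R).

(** Integrability of [f] from every state of [S] keeps [mean] finite and makes it linear in [f]. *)
Let good (h f : E -> R) :=
  [/\ bmeas h, bmeas f,
      forall y, S y -> P.-integrable [set: Omega] (fun w => (f (Y y t w))%:E)
    & P.-integrable [set: Omega] (fun w => (h (Ys w) * f (Yst w))%:E)].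

Let mcomp (f : E -> R) k : bmeas f -> measurable_fun [set: Omega] (fun w => f (Y x k w)).
Proof. by move=> mf; exact: (measurableT_comp mf). Qed.

Let identity_ge0 h f : (forall y, 0 <= h y) -> (forall y, 0 <= f y) ->
  good h f -> identity h f.
Proof.
move=> h0 f0 [mh mf i_f i_hf].
have mfe : measurable_fun [set: borel E] ((EFin \o f) : borel E -> \bar R).
  exact/measurable_EFinP.
have [mpsi eqA] := markov_ge0 (EFin \o f) mfe (fun y => f0 y).
have psiE w : (\int[P]_w' (f (Y (Ys w) t w'))%:E = (mean f (Ys w))%:E)%E.
  by rewrite /mean /Rintegral fineK//; exact/integrable_fin_num/i_f.
have mean0 y : 0 <= mean f y by apply: Rintegral_ge0.
have EQ : (\int[P]_w (h (Ys w) * f (Yst w))%:E =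
           \int[P]_w (h (Ys w) * mean f (Ys w))%:E)%E.
  under eq_integral do rewrite EFinM.
  under [RHS]eq_integral do rewrite EFinM -psiE.
  apply: (@tower_ge0 R _ _ Omega (borel E) P (Y x s) (fun w => (f (Yst w))%:E)
     (fun w => \int[P]_w' (f (Y (Ys w) t w'))%:E)%E _ _ _ _ _ (EFin \o h)) => //.
  - by apply/measurable_EFinP; exact: mcomp.
  - by move=> w; rewrite lee_fin f0 ltry.
  - by move=> w; rewrite psiE lee_fin mean0 ltry.
  - exact/measurable_EFinP.
have mmean : measurable_fun [set: Omega] (fun w => mean f (Ys w)).
  by apply/measurable_EFinP; move: mpsi; under eq_fun do rewrite psiE.
split; last by rewrite /Rintegral EQ.
apply/integrableP; split.
  by apply/measurable_EFinP; apply: measurable_funM => //; exact: mcomp.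
under eq_integral do rewrite gee0_abs ?lee_fin ?mulr_ge0//.
rewrite -EQ; have /integrableP[_] := i_hf.
by under eq_integral do rewrite gee0_abs ?lee_fin ?mulr_ge0//.
Qed.

Let identityBr h f1 f2 : good h f1 -> good h f2 ->
  identity h f1 -> identity h f2 -> identity h (fun y => f1 y - f2 y).
Proof.
move=> [_ _ i1 j1] [_ _ i2 j2] [k1 e1] [k2 e2].
have mB w : mean (fun y => f1 y - f2 y) (Ys w) = mean f1 (Ys w) - mean f2 (Ys w).
  by rewrite /mean RintegralB//; [exact: i1|exact: i2].
split.
  under eq_fun do rewrite mB mulrBr EFinB.
  exact: integrableB.
under eq_Rintegral do rewrite mulrBr.
under [RHS]eq_Rintegral do rewrite mB mulrBr.
by rewrite !RintegralB// e1 e2.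
Qed.

Let identityBl h1 h2 f : good h1 f -> good h2 f ->
  identity h1 f -> identity h2 f -> identity (fun y => h1 y - h2 y) f.
Proof.
move=> [_ _ i1 j1] [_ _ i2 j2] [k1 e1] [k2 e2].
split.
  under eq_fun do rewrite mulrBl EFinB.
  exact: integrableB.
under eq_Rintegral do rewrite mulrBl.
under [RHS]eq_Rintegral do rewrite mulrBl.
by rewrite !RintegralB// e1 e2.
Qed.

Let posneg (f : E -> R) : f = (fun y => f^\+ y - f^\- y).
Proof. by rewrite -[LHS]funrposBneg. Qed.

Let pos_le (f : E -> R) y : `|f^\+ y| <= `|f y|.
Proof. by rewrite ger0_norm ?funrpos_ge0// /funrpos ge_max ler_norm normr_ge0. Qed.

Let neg_le (f : E -> R) y : `|f^\- y| <= `|f y|.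
Proof.
by rewrite ger0_norm ?funrneg_ge0// /funrneg ge_max -normrN ler_norm normr_ge0.
Qed.

Let bmeas_pos f : bmeas f -> bmeas f^\+.
Proof. exact: measurable_funrpos. Qed.

Let bmeas_neg f : bmeas f -> bmeas f^\-.
Proof. exact: measurable_funrneg. Qed.

Let good_le h f h' f' : (forall y, `|h' y| <= `|h y|) ->
  (forall y, `|f' y| <= `|f y|) -> bmeas h' -> bmeas f' -> good h f -> good h' f'.
Proof.
move=> hh ff mh' mf' [mh mf i_f i_hf]; split => //.
  move=> y Sy; apply: (le_integrable measurableT _ _ (i_f y Sy)).
    by apply/measurable_EFinP; exact: (measurableT_comp mf').
  by move=> w _; rewrite lee_fin.
apply: (le_integrable measurableT _ _ i_hf).
  by apply/measurable_EFinP; apply: measurable_funM; exact: mcomp.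
by move=> w _; rewrite lee_fin !normrM ler_pM.
Qed.

(** The four products of positive and negative parts are dominated by the product of [h] and [f], so
    each falls under the nonnegative case. Linearity then recombines [f] for each part of [h], and
    afterwards [h]. *)
Lemma markov_identity (h f : E -> R) :
  bmeas h -> bmeas f ->
  (forall y, S y -> P.-integrable [set: Omega] (fun w => (f (Y y t w))%:E)) ->
  P.-integrable [set: Omega] (fun w => (h (Ys w) * f (Yst w))%:E) ->
  P.-integrable [set: Omega] (fun w => (h (Ys w) * mean f (Ys w))%:E) /\
  \int[P]_w (h (Ys w) * f (Yst w)) = \int[P]_w (h (Ys w) * mean f (Ys w)).
Proof.
move=> mh mf i_f i_hf; have G : good h f by [].
have hE := posneg h.
have fE := posneg f.
have Gpp : good h^\+ f^\+ by apply: good_le G => //; [exact: bmeas_pos..].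
have Gpn : good h^\+ f^\- by apply: good_le G => //; [exact: bmeas_pos|exact: bmeas_neg].
have Gnp : good h^\- f^\+ by apply: good_le G => //; [exact: bmeas_neg|exact: bmeas_pos].
have Gnn : good h^\- f^\- by apply: good_le G => //; [exact: bmeas_neg..].
have Gp : good h^\+ f by apply: good_le G => //; exact: bmeas_pos.
have Gn : good h^\- f by apply: good_le G => //; exact: bmeas_neg.
have f0p : forall y, 0 <= f^\+ y by exact: funrpos_ge0.
have f0n : forall y, 0 <= f^\- y by exact: funrneg_ge0.
have h0p : forall y, 0 <= h^\+ y by exact: funrpos_ge0.
have h0n : forall y, 0 <= h^\- y by exact: funrneg_ge0.
have Ipp := identity_ge0 _ _ h0p f0p Gpp; have Ipn := identity_ge0 _ _ h0p f0n Gpn.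
have Inp := identity_ge0 _ _ h0n f0p Gnp; have Inn := identity_ge0 _ _ h0n f0n Gnn.
have Ip : identity h^\+ f by rewrite fE; exact: identityBr.
have In : identity h^\- f by rewrite fE; exact: identityBr.
by rewrite -/(identity h f) hE; exact: identityBl.
Qed.

(* The conditional expectation given [Y x s] of [f (Y x (s + t))] is
   [mean f (Y x s)], which lies within [G] of the constant [c]. *)
Lemma markov_cov_le (h f G : E -> R) (c : R) :
  bmeas h -> bmeas f ->
  (forall y, S y -> P.-integrable [set: Omega] (fun w => (f (Y y t w))%:E)) ->
  P.-integrable [set: Omega] (fun w => (h (Ys w) * f (Yst w))%:E) ->
  P.-integrable [set: Omega] (fun w => (h (Ys w))%:E) ->
  P.-integrable [set: Omega] (fun w => (`|h (Ys w)| * G (Ys w))%:E) ->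
  (forall y, S y -> `|\int[P]_w f (Y y t w) - c| <= G y) ->
  `|\int[P]_w (h (Ys w) * (f (Yst w) - c))| <= \int[P]_w (`|h (Ys w)| * G (Ys w)).
Proof.
move=> mh mf i_f i_hf i_h i_hG fG.
have [i_m e] := markov_identity h f mh mf i_f i_hf.
have i_hc : P.-integrable [set: Omega] (fun w => (h (Ys w) * c)%:E).
  by under eq_fun do rewrite EFinM muleC; exact: integrableZl.
have -> : \int[P]_w (h (Ys w) * (f (Yst w) - c)) = \int[P]_w (h (Ys w) * (mean f (Ys w) - c)).
  under eq_Rintegral do rewrite mulrBr.
  under [RHS]eq_Rintegral do rewrite mulrBr.
  by rewrite !RintegralB// e.
have i_d : P.-integrable [set: Omega] (fun w => (h (Ys w) * (mean f (Ys w) - c))%:E).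
  by under eq_fun do rewrite mulrBr EFinB; exact: integrableB.
apply: (le_trans (le_normr_Rintegral measurableT i_d)).
apply: le_Rintegral => //; first exact: integrable_norm.
by move=> w _; rewrite normrM ler_wpM2l//; exact: fG.
Qed.

End MarkovIdentity.

(** * Growth of the contraction estimate *)

Section Growth.
Context {R : realType}.

(** [K / 2] comes from [dist_expectation_le], [(3 L4)^b] from the contraction modulus, and the last
    factor from the constant 3 and two interpolated moments. *)
Definition growth_const (K p q L3 b L4 : R) : R :=
  K / 2 * (3 * L4) `^ b * (3 + 4 * (2 * L3) `^ (p / q)).

(** Here [s] and [t] stand for the norms of two starting points and [d] for their distance. All
    three are at most [N = (1 + s) (1 + t)], and [N >= 1], so every factor is bounded by a power of
    [N], which splits into a product of one weight for each point. *)
Lemma contraction_growth_le (K p q qt L3 b kappa L4 s t d r : R) :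
  0 <= K -> 0 < p -> 0 < q -> 1 <= qt -> 0 < L3 -> 0 < b -> 0 <= kappa -> 0 < L4 ->
  0 <= s -> 0 <= t -> 0 <= d <= s + t -> 0 <= r ->
  K * ((L4 * d * (1 + s `^ kappa + t `^ kappa) * r) `^ b / 2) *
    (3 + 2 * (L3 * (1 + s `^ (qt * q))) `^ (p / q)
       + 2 * (L3 * (1 + t `^ (qt * q))) `^ (p / q)) <=
  growth_const K p q L3 b L4 * r `^ b *
    ((1 + s) `^ ((1 + kappa) * b + qt * p) * (1 + t) `^ ((1 + kappa) * b + qt * p)).
Proof.
move=> K0 p0 q0 qt1 L30 b0 k0 L40 s0 t0 /andP[d0 dst] r0.
pose N := (1 + s) * (1 + t).
have N1 : 1 <= N by rewrite /N; nra.
have sN : s <= N by rewrite /N; nra.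
have tN : t <= N by rewrite /N; nra.
have N0 : 0 <= N by lra.
have Np : 0 < N by lra.
have pow1 (z : R) : 0 <= z -> 1 <= N `^ z.
  by move=> z0; have := ler_powR N1 z0; rewrite powRr0.
have pows (a z : R) : 0 <= z -> 0 <= a -> a <= N -> a `^ z <= N `^ z.
  by move=> z0 a0 aN; apply: ge0_ler_powR; rewrite ?nnegrE.
have qt0 : 0 <= qt by lra.
have e1 : (L4 * d * (1 + s `^ kappa + t `^ kappa) * r) `^ b <=
    (3 * L4) `^ b * N `^ ((1 + kappa) * b) * r `^ b.
  have -> : (3 * L4) `^ b * N `^ ((1 + kappa) * b) * r `^ b =
      (3 * L4 * (N * N `^ kappa) * r) `^ b.
    have h3L : 0 <= 3 * L4 by lra.
    have hNN : 0 <= N * N `^ kappa by rewrite mulr_ge0 ?powR_ge0.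
    rewrite (powRM _ (mulr_ge0 h3L hNN) r0) (powRM _ h3L hNN).
    congr (_ * _ * _).
    have {2}-> : N = N `^ 1 by rewrite powRr1.
    by rewrite powRrM [N `^ (1 + _)]powRD// (gt_eqF Np) implybT.
  have A0 := powR_ge0 s kappa; have B0 := powR_ge0 t kappa.
  have h1 := pow1 kappa k0; have h2 := pows s kappa k0 s0 sN.
  have h3 := pows t kappa k0 t0 tN.
  have dN : d <= N by rewrite /N; nra.
  apply: ge0_ler_powR; rewrite ?nnegrE; try lra.
  - by rewrite !mulr_ge0//; lra.
  - by rewrite !mulr_ge0 ?powR_ge0//; lra.
  apply: ler_wpM2r => //; rewrite (_ : 3 * L4 * _ = L4 * N * (3 * N `^ kappa)); last by ring.
  apply: ler_pM; [by rewrite mulr_ge0// ltW|lra|by rewrite ler_wpM2l// ltW|lra].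
have e2 u : 0 <= u -> u <= N -> (L3 * (1 + u `^ (qt * q))) `^ (p / q) <=
    (2 * L3) `^ (p / q) * N `^ (qt * p).
  move=> u0 uN.
  have -> : N `^ (qt * p) = (N `^ (qt * q)) `^ (p / q).
    by rewrite -powRrM; congr (_ `^ _); field; rewrite gt_eqF.
  rewrite -powRM ?powR_ge0//; last by lra.
  have h0 := powR_ge0 u (qt * q).
  have qq : 0 <= qt * q by rewrite mulr_ge0// ltW.
  have h1 := pow1 _ qq; have h2 := pows u _ qq u0 uN.
  apply: ge0_ler_powR; rewrite ?nnegrE.
  - by rewrite divr_ge0// ltW.
  - by rewrite mulr_ge0//; lra.
  - by rewrite mulr_ge0 ?powR_ge0//; lra.
  - by rewrite (mulrC 2) -mulrA ler_wpM2l//; lra.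
have N2 : 1 <= N `^ (qt * p) by apply: pow1; rewrite mulr_ge0// ltW.
have c0 := powR_ge0 (2 * L3) (p / q).
have e3 : 3 + 2 * (L3 * (1 + s `^ (qt * q))) `^ (p / q)
       + 2 * (L3 * (1 + t `^ (qt * q))) `^ (p / q) <=
    (3 + 4 * (2 * L3) `^ (p / q)) * N `^ (qt * p).
  rewrite (_ : (3 + 4 * (2 * L3) `^ (p / q)) * N `^ (qt * p) =
    3 * N `^ (qt * p) + 2 * ((2 * L3) `^ (p / q) * N `^ (qt * p)) +
    2 * ((2 * L3) `^ (p / q) * N `^ (qt * p))); last by ring.
  apply: lerD; last by apply: ler_wpM2l => //; exact: e2.
  apply: lerD; last by apply: ler_wpM2l => //; exact: e2.
  by rewrite -[leLHS]mulr1; exact: ler_wpM2l.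
rewrite -powRM ?addr_ge0// -/N powRD; last by rewrite (gt_eqF Np) implybT.
rewrite /growth_const.
have -> : K / 2 * (3 * L4) `^ b * (3 + 4 * (2 * L3) `^ (p / q)) * r `^ b *
    (N `^ ((1 + kappa) * b) * N `^ (qt * p)) =
  (K / 2 * ((3 * L4) `^ b * N `^ ((1 + kappa) * b) * r `^ b)) *
  ((3 + 4 * (2 * L3) `^ (p / q)) * N `^ (qt * p)) by ring.
apply: ler_pM => //.
- by rewrite !mulr_ge0 ?powR_ge0.
- by rewrite addr_ge0 ?mulr_ge0 ?powR_ge0// addr_ge0 ?mulr_ge0 ?powR_ge0.
- by rewrite mulrA [_ * 2^-1]mulrAC ler_wpM2l// mulr_ge0.
Qed.

Lemma growth_const_ge0 (K p q L3 b L4 : R) : 0 <= K -> 0 <= growth_const K p q L3 b L4.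
Proof.
by move=> K0; rewrite /growth_const !mulr_ge0 ?powR_ge0// addr_ge0// mulr_ge0// powR_ge0.
Qed.

Lemma powR_1D_le (t s q : R) : 0 <= t -> 0 <= s <= q ->
  (1 + t) `^ s <= 2 `^ q * (1 + t `^ q).
Proof.
move=> t0 /andP[s0 sq]; have q0 := le_trans s0 sq.
apply: (@le_trans _ _ ((1 + t) `^ q)); first by rewrite ler_powR//; lra.
have m1 : 1 <= Num.max 1 t by rewrite le_max lexx.
have m2 : t <= Num.max 1 t by rewrite le_max lexx orbT.
apply: (@le_trans _ _ ((2 * Num.max 1 t) `^ q)).
  by apply: ge0_ler_powR; rewrite ?nnegrE; lra.
rewrite powRM//; last by lra.
rewrite ler_wpM2l ?powR_ge0//; have h := powR_ge0 t q.
by rewrite /Order.max; case: ifP => _; [lra|rewrite powR1; lra].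
Qed.

End Growth.

(** * Ergodicity of a discretization *)

Section PolynomialGrowth.
Context {R : realType} {E : completeNormedModType R}.
Context {d : measure_display} {Omega : measurableType d} (P : probability Omega R).

Lemma measurable_1D_powR s : measurable_fun [set: borel E]
  ((fun u : E => (1 + `|u|) `^ s) : borel E -> R).
Proof.
apply: (measurableT_comp (f := @powR R ^~ s)); first exact: measurable_powR.
apply: measurable_funD => //; apply: continuous_borel_measurable => u.
exact: norm_continuous.
Qed.

Lemma mfun_comp_measurable (g : E -> R) (U : {mfun Omega >-> borel E}) :
  measurable_fun [set: borel E] (g : borel E -> R) ->
  measurable_fun [set: Omega] (fun w => g (U w)).
Proof. by move=> mg; exact: (measurableT_comp mg). Qed.

Lemma integral_1D_powR_le (U : {mfun Omega >-> borel E}) (q s M : R) :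
  0 <= s <= q -> (moment P q U <= M%:E)%E ->
  (\int[P]_w ((1 + `|U w : E|) `^ s)%:E <= (2 `^ q * (1 + M))%:E)%E.
Proof.
move=> sq UM.
have mU : measurable_fun [set: Omega] (fun w => (`|U w : E| `^ q)%:E).
  by apply/measurable_EFinP; exact: measurable_normpowR.
have h0 w : (0 <= (`|U w : E| `^ q)%:E)%E by rewrite lee_fin powR_ge0.
have m1 : measurable_fun [set: Omega] (fun w => 1 + (`|U w : E| `^ q)%:E)%E.
  exact: emeasurable_funD.
have h1 w : (0 <= 1 + (`|U w : E| `^ q)%:E)%E by rewrite adde_ge0.
apply: (@le_trans _ _ (\int[P]_w ((2 `^ q)%:E * (1 + (`|U w : E| `^ q)%:E)))%E).
  apply: ge0_le_integral => //.
  - by apply/measurable_EFinP; exact: (mfun_comp_measurable _ _ (measurable_1D_powR s)).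
  - exact: measurable_funeM.
  - by move=> w _; rewrite -EFinM lee_fin; exact: powR_1D_le.
rewrite ge0_integralZl_EFin ?powR_ge0// [X in (_ <= X)%E]EFinM.
apply: lee_wpmul2l; first by rewrite lee_fin powR_ge0.
by rewrite ge0_integralD// integral_prob_cst [X in (_ <= X)%E]EFinD leeD2l// -momentE.
Qed.

Lemma integrable_poly_growth (U : {mfun Omega >-> borel E}) (g : E -> R) (C q s M : R) :
  measurable_fun [set: borel E] (g : borel E -> R) ->
  (forall u, `|g u| <= C * (1 + `|u|) `^ s) ->
  0 <= s <= q -> (moment P q U <= M%:E)%E ->
  P.-integrable [set: Omega] (fun w => (g (U w))%:E).
Proof.
move=> mg gC sq UM.
have i1 : P.-integrable [set: Omega] (fun w => ((1 + `|U w : E|) `^ s)%:E).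
  apply/integrableP; split.
    by apply/measurable_EFinP; exact: (mfun_comp_measurable _ _ (measurable_1D_powR s)).
  under eq_integral do rewrite gee0_abs ?lee_fin ?powR_ge0//.
  exact: le_lt_trans (integral_1D_powR_le _ _ _ _ sq UM) (ltry _).
apply: (le_integrable measurableT _ _ (integrableZl measurableT C i1)).
  by apply/measurable_EFinP; exact: mfun_comp_measurable.
move=> w _; rewrite -EFinM lee_fin (le_trans (gC _))//; exact: ler_norm.
Qed.

Lemma Rintegral_poly_growth_le (U : {mfun Omega >-> borel E}) (g : E -> R) (C q s M : R) :
  measurable_fun [set: borel E] (g : borel E -> R) -> 0 <= C ->
  (forall u, `|g u| <= C * (1 + `|u|) `^ s) ->
  0 <= s <= q -> (moment P q U <= M%:E)%E ->
  \int[P]_w `|g (U w)| <= C * (2 `^ q * (1 + M)).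
Proof.
move=> mg C0 gC sq UM.
have i1 : P.-integrable [set: Omega] (fun w => ((1 + `|U w : E|) `^ s)%:E).
  apply: (integrable_poly_growth U (fun u => (1 + `|u|) `^ s) 1 q s M) => //.
    exact: measurable_1D_powR.
  by move=> u; rewrite mul1r ger0_norm// powR_ge0.
have i2 := integrable_poly_growth U g C q s M mg gC sq UM.
apply: (@le_trans _ _ (\int[P]_w (C * (1 + `|U w : E|) `^ s))).
  apply: le_Rintegral => //; first exact: integrable_norm.
  exact: (integrableZl measurableT C i1).
rewrite RintegralZl// ler_wpM2l//.
rewrite -lee_fin /Rintegral fineK; first exact: integral_1D_powR_le.
exact: integrable_fin_num.
Qed.

(** The weight [(1 + |u|)^s] is preferred to [1 + |u|^s] because products and powers of such weights
    are again of this form. *)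
Lemma one_add_powR_le (K s : R) (u : E) : 0 <= K -> 0 <= s ->
  K * (1 + `|u| `^ s) <= 2 * K * (1 + `|u|) `^ s.
Proof.
move=> K0 s0; rewrite [2 * K]mulrC -mulrA ler_wpM2l//.
have u0 := normr_ge0 u.
have h1 : 1 <= (1 + `|u|) `^ s.
  have u1 : 1 <= 1 + `|u| by lra.
  by have := ler_powR u1 s0; rewrite powRr0.
have : `|u| `^ s <= (1 + `|u|) `^ s by apply: ge0_ler_powR; rewrite ?nnegrE//; lra.
lra.
Qed.

End PolynomialGrowth.

(** * Means and time averages along one chain *)

Section ErgodicChain.
Context {R : realType} {E : completeNormedModType R} (sepE : separable E).
Context {d : measure_display} {Omega : measurableType d} (P : probability Omega R).
Context (S : set E) (Y : E -> nat -> {mfun Omega >-> borel E}).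
Hypothesis mS : measurable (S : set (borel E)).
Hypothesis chainY : markov_chain P S Y.
Context (f : E -> R) (K p gamma b q qt kappa L3 L4 B : R) (rho : nat -> R).
Hypothesis cf : continuous f.
Hypothesis K0 : 0 <= K.
Hypothesis fK : forall u, `|f u| <= K * (1 + `|u| `^ (p / 2)).
Hypothesis fd : forall u v, `|f u - f v| <= K * dpg p gamma u v.
Hypothesis bg : 0 < b <= gamma.
Hypothesis g1 : gamma <= 1.
Hypothesis p1 : 1 <= p.
Hypothesis qt1 : 1 <= qt.
Hypothesis kappa0 : 0 <= kappa.
Hypothesis L30 : 0 < L3.
Hypothesis L40 : 0 < L4.
Hypothesis pq : p * (1 + qt) + 2 * (1 + kappa) * gamma <= q.
Hypothesis rho0 : forall k, 0 <= rho k.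
Hypothesis rhoB : forall n, \sum_(0 <= k < n) rho k `^ b <= B.
Hypothesis momY : forall y k, S y ->
  (moment P q (Y y k) <= (L3 * (1 + `|y| `^ (qt * q)))%:E)%E.
Hypothesis contrY : forall y z k, S y -> S z ->
  (L2dist P (Y y k) (Y z k) <=
   (L4 * `|y - z| * (1 + `|y| `^ kappa + `|z| `^ kappa) * rho k)%:E)%E.

(** The first summand stems from the contraction modulus, the second from the moments of the two
    chains. *)
Let m := (1 + kappa) * b + qt * p.
Let C := growth_const K p q L3 b L4.
Let e k y := \int[P]_w f (Y y k w).

Let mf : measurable_fun [set: borel E] (f : borel E -> R).
Proof. exact: continuous_borel_measurable. Qed.

Let b0 : 0 < b. Proof. by case/andP: bg. Qed.

Let kb : (1 + kappa) * b <= (1 + kappa) * gamma.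
Proof.
have ? : 0 <= 1 + kappa by move: kappa0; lra.
by rewrite ler_wpM2l//; case/andP: bg.
Qed.

Let qtp : 1 <= qt * p. Proof. by rewrite -[leLHS]mulr1 ler_pM. Qed.

Let kb0 : 0 <= (1 + kappa) * b.
Proof. by apply: mulr_ge0; [move: kappa0; lra|exact: ltW]. Qed.

Let m0 : 0 <= m. Proof. by rewrite /m; move: qtp kb0; lra. Qed.

Let mpq : m + p / 2 <= q. Proof. by rewrite /m; move: p1 kb0 kb pq; lra. Qed.

Let p_q : p <= q. Proof. by move: pq p1 qtp kb0 kb; lra. Qed.

Let fK2 u : `|f u| <= 2 * K * (1 + `|u|) `^ (p / 2).
Proof. by apply: (le_trans (fK u)); apply: one_add_powR_le => //; move: p1; lra. Qed.

Lemma chain_integrable y k : S y -> P.-integrable [set: Omega] (fun w => (f (Y y k w))%:E).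
Proof.
move=> Sy; apply: (integrable_poly_growth P (Y y k) f _ q _ _ mf fK2 _ (momY y k Sy)).
by apply/andP; split; move: p1 p_q; lra.
Qed.

Lemma chain_contraction y z k : S y -> S z ->
  `|e k y - e k z| <= C * rho k `^ b * ((1 + `|y|) `^ m * (1 + `|z|) `^ m).
Proof.
move=> Sy Sz.
have hM y' : 0 < L3 * (1 + `|y'| `^ (qt * q)).
  by rewrite mulr_gt0// ltr_wpDr ?powR_ge0.
have pq' : 0 < p <= q by apply/andP; split; move: p1 p_q; lra.
have q0 : 0 < q by move: p1 p_q; lra.
have qt0 : 0 <= qt by move: qt1; lra.
have iy := chain_integrable y k Sy; have iz := chain_integrable z k Sz.
have iB : P.-integrable [set: Omega] (EFin \o (fun w => f (Y y k w) - f (Y z k w))).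
  exact: (integrableB measurableT iy iz).
rewrite /e -RintegralB//.
apply: (le_trans (le_normr_Rintegral measurableT iB)).
apply: le_trans (contraction_growth_le K p q qt L3 b kappa L4 `|y| `|z| `|y - z| (rho k)
    K0 _ _ qt1 L30 b0 kappa0 L40 _ _ _ (rho0 k)) => //; [|by case/andP: pq'|].
- rewrite -lee_fin /Rintegral fineK; last exact/integrable_fin_num/integrable_norm.
  apply: (@dist_expectation_le _ _ _ _ P f K p gamma b) => //.
  + by rewrite !mulr_ge0 ?addr_ge0 ?powR_ge0// ltW.
  + exact: contrY.
  + by apply: le_moment_interp => //; exact: momY.
  + by apply: le_moment_interp => //; exact: momY.
- by rewrite normr_ge0 ler_normB.
Qed.

Context (x : E).
Hypothesis Sx : S x.

(** A bound, uniform in time, for the mean of any weight [(1 + |u|)^s] with [0 <= s <= q] along the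
    chain started at [x]. *)
Let M := 2 `^ q * (1 + L3 * (1 + `|x| `^ (qt * q))).

Let M0 : 0 <= M.
Proof.
by rewrite mulr_ge0 ?powR_ge0// addr_ge0// mulr_ge0 ?addr_ge0 ?powR_ge0// ltW.
Qed.

Let C0 : 0 <= C. Proof. exact: growth_const_ge0. Qed.

Lemma chain_ergodic_step y k n : S y ->
  `|e (n + k)%N x - e k y| <= C * M * rho k `^ b * (1 + `|y|) `^ m.
Proof.
move=> Sy.
pose G (u : E) := C * rho k `^ b * ((1 + `|u|) `^ m * (1 + `|y|) `^ m).
pose c := C * rho k `^ b * (1 + `|y|) `^ m.
have c0 : 0 <= c by apply: mulr_ge0; [apply: mulr_ge0|]; rewrite ?powR_ge0 ?C0.
have GE u : G u = c * (1 + `|u|) `^ m by rewrite /G /c; ring.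
have mG : measurable_fun [set: borel E] (G : borel E -> R).
  by apply: measurable_funM => //; apply: measurable_funM => //; exact: measurable_1D_powR.
have Gle u : `|G u| <= c * (1 + `|u|) `^ m by rewrite GE ger0_norm// mulr_ge0// powR_ge0.
have mq : 0 <= m <= q by apply/andP; split => //; move: mpq p1; lra.
have iG := integrable_poly_growth P (Y x n) G c q m _ mG Gle mq (momY x n Sx).
have i1 : P.-integrable [set: Omega] (fun w : Omega => (1:R)%:E).
  exact: finite_measure_integrable_cst.
have ink := chain_integrable x (n + k) Sx.
have E1 : \int[P]_w (1 * (f (Y x (n + k)%N w) - e k y)) = e (n + k)%N x - e k y.
  under eq_Rintegral do rewrite mul1r.
  rewrite RintegralB//; last exact: finite_measure_integrable_cst.
  by rewrite Rintegral_cst// [X in fine X](_ : _ = 1%E) ?mulr1//; exact: probability_setT.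
have E2 : \int[P]_w (`|1 : R| * G (Y x n w)) = \int[P]_w G (Y x n w).
  by under eq_Rintegral do rewrite normr1 mul1r.
apply: (@le_trans _ _ (\int[P]_w G (Y x n w))).
  rewrite -E1 -E2.
  (* The first factor is 1 and the constant is [e k y]: given [Y x n], the conditional mean of [f]
     at time [n + k] is [e k] at that state, which contraction places within [G] of [e k y]. *)
  apply: (@markov_cov_le R E d Omega P S Y mS chainY x n k Sx (fun=> 1) f G (e k y)) => //.
  - by move=> z Sz; exact: chain_integrable.
  - by under eq_fun do rewrite mul1r.
  - by under eq_fun do rewrite normr1 mul1r.
  - by move=> z Sz; exact: chain_contraction.
have := Rintegral_poly_growth_le P (Y x n) G c q m _ mG c0 Gle mq (momY x n Sx).
have -> : \int[P]_w `|G (Y x n w)| = \int[P]_w G (Y x n w).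
  by apply: eq_Rintegral => w _; rewrite ger0_norm// GE mulr_ge0// powR_ge0.
move/le_trans; apply; rewrite -/M /c le_eqVlt; apply/orP; left; apply/eqP; ring.
Qed.

Let rhob_cvg0 : rho k `^ b @[k --> \oo] --> 0.
Proof.
apply: cvg_series_cvg_0; apply: nondecreasing_is_cvgn.
  by apply/nondecreasing_seqP => n; rewrite /series/= big_nat_recr//= lerDl powR_ge0.
by exists B => _ [n _ <-]; exact: rhoB.
Qed.

(** For [y = x] the bound on [|e (n + k) x - e k x|] does not involve [n], whence the Cauchy
    property. Letting [n] tend to infinity for arbitrary [y] shows that [a] is approached from every
    state of [S] at the rate [rho_k^b]. *)
Lemma chain_mean_cvg : exists2 a : R, e k x @[k --> \oo] --> a &
  forall y k, S y -> `|e k y - a| <= C * M * rho k `^ b * (1 + `|y|) `^ m.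
Proof.
have cv : cvg (e k x @[k --> \oo]).
  apply/cauchy_cvgP/cauchy_exP => eps eps0.
  have : (C * M * rho k `^ b * (1 + `|x|) `^ m) @[k --> \oo] --> (0 : R).
    rewrite -[0](mul0r ((1 + `|x|) `^ m)); apply: cvgMr_tmp.
    by rewrite -[0](mulr0 (C * M)); apply: cvgMl_tmp.
  move=> /cvgrPdist_lt/(_ _ eps0)[N _ /(_ N (leqnn N))] /=.
  rewrite sub0r normrN => HN.
  exists (e N x), N => // n /= Nn.
  rewrite -ball_normE/= -(subnK Nn) distrC.
  apply: (le_lt_trans (chain_ergodic_step x N (n - N) Sx)).
  exact: (le_lt_trans (ler_norm _)).
exists (lim (e k x @[k --> \oo])) => // y k Sy.
have h : `|e k y - e (n + k)%N x| @[n --> \oo] --> `|e k y - lim (e k x @[k --> \oo])|.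
  apply: cvg_norm; apply: cvgB; first exact: cvg_cst.
  by rewrite (cvg_shiftn k (e ^~ x)).
rewrite -(cvg_lim _ h)//.
apply: limr_le; first by apply/cvg_ex; eexists; exact: h.
by apply: nearW => n; rewrite distrC; exact: chain_ergodic_step.
Qed.

Lemma chain_time_average_cvg (a : R) :
  (forall y k, S y -> `|e k y - a| <= C * M * rho k `^ b * (1 + `|y|) `^ m) ->
  {ae P, forall w, time_average f (Y x) k w @[k --> \oo] --> a}.
Proof.
(* The constant [a] is absorbed into [K'] because the weights are at least 1. *)
move=> ea; pose K' := 2 * K + `|a|; pose h (u : E) := f u - a.
have K'0 : 0 <= K' by rewrite /K' addr_ge0// mulr_ge0.
have pge1 (s : R) (u : E) : 0 <= s -> 1 <= (1 + `|u|) `^ s.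
  move=> s0; have u1 : 1 <= 1 + `|u| by rewrite lerDl.
  by have := ler_powR u1 s0; rewrite powRr0.
have p20 : 0 <= p / 2 by move: p1; lra.
have hK u : `|h u| <= K' * (1 + `|u|) `^ (p / 2).
  rewrite /h /K' mulrDl (le_trans (ler_normB _ _))// lerD//.
  by rewrite -[leLHS]mulr1 ler_wpM2l// pge1.
have mh : measurable_fun [set: borel E] (h : borel E -> R).
  exact: measurable_funB.
pose h2 (u : E) := h u ^+ 2.
have mh2 : measurable_fun [set: borel E] (h2 : borel E -> R) by exact: measurable_funX.
have sqp (u : E) : ((1 + `|u|) `^ (p / 2)) ^+ 2 = (1 + `|u|) `^ p.
  by rewrite -powR_mulrn ?powR_ge0// -powRrM divfK.
have hK2 u : `|h2 u| <= K' ^+ 2 * (1 + `|u|) `^ p.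
  rewrite /h2 ger0_norm ?sqr_ge0// -sqp -exprMn -real_normK ?num_real//.
  by rewrite lerXn2r ?nnegrE// mulr_ge0 ?powR_ge0.
have pq' : 0 <= p <= q by apply/andP; split; move: p1 p_q; lra.
have ih2 i := integrable_poly_growth P (Y x i) h2 _ q p _ mh2 hK2 pq' (momY x i Sx).
have mhY i : measurable_fun [set: Omega] (fun w => h (Y x i w)).
  exact: mfun_comp_measurable.
have pq2 : 0 <= p / 2 <= q by apply/andP; split; move: p1 p_q; lra.
have ih i := integrable_poly_growth P (Y x i) h _ q _ _ mh hK pq2 (momY x i Sx).
(* [h] is centred at the limit [a], not at the mean of each variable; conditioning on [Y x i] still
   leaves a factor of order [rho_k^b] times a weight. One [M] is part of that factor, the other
   comes from integrating [|h|] times the weight over the law of [Y x i]. *)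
have cov i k : `|\int[P]_w (h (Y x i w) * h (Y x (i + k)%N w))| <=
    K' * C * M * M * rho k `^ b.
  pose c := C * M * rho k `^ b; pose G (u : E) := c * (1 + `|u|) `^ m.
  have c0 : 0 <= c by apply: mulr_ge0; [exact: mulr_ge0|exact: powR_ge0].
  have G0 u : 0 <= G u by rewrite mulr_ge0// powR_ge0.
  have mG : measurable_fun [set: borel E] (G : borel E -> R).
    by apply: measurable_funM => //; exact: measurable_1D_powR.
  pose hG (u : E) := `|h u| * G u.
  have mhG : measurable_fun [set: borel E] (hG : borel E -> R).
    by apply: measurable_funM => //; exact: measurableT_comp.
  have mpq2 : 0 <= p / 2 + m <= q.
    by apply/andP; split; [rewrite addr_ge0|move: mpq; lra].
  have hGK u : `|hG u| <= (K' * c) * (1 + `|u|) `^ (p / 2 + m).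
    rewrite /hG normrM normr_id (ger0_norm (G0 u)) /G.
    rewrite [X in _ <= _ * X]powRD; last first.
      have -> : (1 + `|u| != 0) by rewrite gt_eqF// ltr_pwDl.
      by rewrite implybT.
    by rewrite mulrACA ler_wpM2r // G0.
  have ihG := integrable_poly_growth P (Y x i) hG _ q _ _ mhG hGK mpq2 (momY x i Sx).
  have ihf : P.-integrable [set: Omega] (fun w => (h (Y x i w) * f (Y x (i + k)%N w))%:E).
    have j1 := integrable_mul_sqr P _ _ (mhY i) (mhY (i + k)%N) (ih2 i) (ih2 (i + k)%N).
    have j2 := integrableD measurableT j1 (integrableZl measurableT a (ih i)).
    apply: eq_integrable j2 => // w _ /=.
    by rewrite -EFinM -EFinD; congr (_%:E); rewrite /h; ring.
  have := @markov_cov_le R E d Omega P S Y mS chainY x i k Sx h f G a mh mf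
    (fun y Sy => chain_integrable y k Sy) ihf (ih i) ihG (fun y Sy => ea y k Sy).
  move/le_trans; apply.
  have KC0 : 0 <= K' * c by exact: mulr_ge0.
  have := Rintegral_poly_growth_le P (Y x i) hG _ q _ _ mhG KC0 hGK mpq2 (momY x i Sx).
  have -> : \int[P]_w `|hG (Y x i w)| = \int[P]_w (`|h (Y x i w)| * G (Y x i w)).
    by apply: eq_Rintegral => w _; rewrite ger0_norm// mulr_ge0.
  move/le_trans; apply; rewrite -/M le_eqVlt; apply/orP; left; apply/eqP.
  rewrite /c; ring.
have xi2 i : (\int[P]_w (h (Y x i w) ^+ 2)%:E <= (K' ^+ 2 * M)%:E)%E.
  have := Rintegral_poly_growth_le P (Y x i) h2 _ q p _ mh2 (sqr_ge0 K') hK2 pq' (momY x i Sx).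
  have -> : \int[P]_w `|h2 (Y x i w)| = \int[P]_w h2 (Y x i w).
    by apply: eq_Rintegral => w _; rewrite ger0_norm// sqr_ge0.
  rewrite -/M -lee_fin /Rintegral fineK//; exact: (integrable_fin_num measurableT (ih2 i)).
have KB n : \sum_(0 <= k < n) (K' * C * M * M * rho k `^ b) <= K' * C * M * M * B.
  rewrite -mulr_sumr ler_wpM2l//.
  by apply: mulr_ge0 => //; apply: mulr_ge0 => //; exact: mulr_ge0.
have := slln_of_cov P (fun i w => h (Y x i w)) _ _ _ mhY xi2 cov KB.
apply: filterS => w hw; rewrite /time_average.
have -> : a = 0 + a by rewrite add0r.
apply: (cvg_trans _ (cvgD hw (cvg_cst a))).
(* At [n = 0] both averages vanish, so the identity with [a] added starts at [n = 1]. *)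
apply: near_eq_cvg; exists 1%N => // n /= n0.
have nn : n%:R != 0 :> R by rewrite pnatr_eq0 -lt0n.
have -> : \sum_(i < n) f (Y x i w) = \sum_(i < n) h (Y x i w) + a *+ n.
  by rewrite /h sumrB sumr_const card_ord subrK.
by rewrite mulrDr -[a *+ n]mulr_natl mulKf.
Qed.

End ErgodicChain.

(** * Moments and times for the continuous process *)

Section MomentApproximation.
Context {R : realType} {E : completeNormedModType R} (sepE : separable E).
Context {d : measure_display} {Omega : measurableType d} (P : probability Omega R).

Lemma powRD_le (a b q : R) : 0 <= a -> 0 <= b -> 0 <= q ->
  (a + b) `^ q <= 2 `^ q * (a `^ q + b `^ q).
Proof.
move=> a0 b0 q0; have A0 := powR_ge0 a q; have B0 := powR_ge0 b q.
have h : forall u v : R, 0 <= u -> u <= v -> u `^ q <= v `^ q.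
  by move=> u v u0 uv; apply: ge0_ler_powR; rewrite ?nnegrE//; exact: le_trans uv.
have [ab|ba] := leP a b.
  apply: (@le_trans _ _ ((2 * b) `^ q)); first by apply: h; lra.
  by rewrite powRM// ler_wpM2l ?powR_ge0//; lra.
apply: (@le_trans _ _ ((2 * a) `^ q)); first by apply: h; lra.
by rewrite powRM// ler_wpM2l ?powR_ge0//; lra.
Qed.

(** Below the level [N] all but two of the [q] powers are traded for a constant, so that an [L^2]
    bound controls a truncated moment of order [q]. *)
Lemma min_powR_le (s N q : R) : 0 <= s -> 0 <= N -> 2 <= q ->
  Num.min s N `^ q <= N `^ (q - 2) * s ^+ 2.
Proof.
move=> s0 N0 q2; set z := Num.min s N.
have z0 : 0 <= z by rewrite le_min s0.
have [zs zN] : z <= s /\ z <= N by rewrite /z !ge_min !lexx orbT.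
have [->|zn0] := eqVneq z 0.
  by rewrite powR0 ?gt_eqF ?mulr_ge0 ?powR_ge0 ?sqr_ge0//; lra.
have -> : z `^ q = z `^ (q - 2) * z ^+ 2.
  by rewrite -powR_mulrn// -powRD ?subrK// (negPf zn0) implybT.
apply: ler_pM; [exact: powR_ge0|exact: sqr_ge0| |].
  by apply: ge0_ler_powR; rewrite ?nnegrE//; lra.
by rewrite lerXn2r ?nnegrE.
Qed.

(** Closeness in [L^2] does not control moments of order [q] directly. After truncation,
    [min |U| n <= |V| + min |U - V| n], and the last term is small in [L^q] once [eta] is small
    compared with [n]. The resulting bound is free of [n], so monotone convergence removes the
    truncation. *)
Lemma le_moment_approx (q M : R) (U : {mfun Omega >-> borel E}) : 2 <= q -> 0 <= M ->
  (forall eta : R, 0 < eta -> exists V : {mfun Omega >-> borel E},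
     (moment P q V <= M%:E)%E /\ (L2dist P U V <= eta%:E)%E) ->
  (moment P q U <= (2 `^ q * (M + 1))%:E)%E.
Proof.
move=> q2 M0 UV; have q0 : 0 <= q by lra.
pose g n w := (Num.min `|U w : E| n%:R) `^ q.
have mnorm : measurable_fun [set: Omega] (fun w => `|U w : E|).
  apply: (measurableT_comp (f := fun u : borel E => `|u : E|)) => //.
  by apply: continuous_borel_measurable => u; exact: norm_continuous.
have mg n : measurable_fun [set: Omega] (fun w => (g n w)%:E).
  apply/measurable_EFinP; apply: (measurableT_comp (f := @powR R ^~ q)).
    exact: measurable_powR.
  exact: measurable_minr.
have ig n : (\int[P]_w (g n w)%:E <= (2 `^ q * (M + 1))%:E)%E.
  pose c : R := n%:R `^ (q - 2).
  have c0 : 0 <= c by exact: powR_ge0.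
  (* Chosen so that [c * eta^2 <= 1]; the approximant [V] varies with the level [n]. *)
  pose eta := (c + 1)^-1.
  have eta0 : 0 < eta by rewrite invr_gt0; lra.
  have [V [VM UVeta]] := UV eta eta0.
  have sq := L2dist_sqr P U V eta (ltW eta0) UVeta.
  have ms : measurable_fun [set: Omega] (fun w => (`|(U w : E) - V w| ^+ 2)%:E).
    by apply/measurable_EFinP/measurable_funX; exact: measurable_dist.
  have mV : measurable_fun [set: Omega] (fun w => (`|V w : E| `^ q)%:E).
    by apply/measurable_EFinP; exact: measurable_normpowR.
  have V0 w : (0 <= (`|V w : E| `^ q)%:E)%E by rewrite lee_fin powR_ge0.
  have s0 w : (0 <= (`|(U w : E) - V w| ^+ 2)%:E)%E by rewrite lee_fin sqr_ge0.
  have cs0 w : (0 <= c%:E * (`|(U w : E) - V w| ^+ 2)%:E)%E by rewrite mule_ge0.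
  have mcs := measurable_funeM c%:E ms.
  have msum : measurable_fun [set: Omega]
      (fun w => (`|V w : E| `^ q)%:E + c%:E * (`|(U w : E) - V w| ^+ 2)%:E)%E.
    exact: emeasurable_funD.
  have sum0 w : (0 <= (`|V w : E| `^ q)%:E + c%:E * (`|(U w : E) - V w| ^+ 2)%:E)%E.
    by rewrite adde_ge0.
  apply: (@le_trans _ _ (\int[P]_w ((2 `^ q)%:E *
      ((`|V w : E| `^ q)%:E + c%:E * (`|(U w : E) - V w| ^+ 2)%:E)))%E).
    apply: ge0_le_integral => //.
    - by move=> w _; rewrite lee_fin powR_ge0.
    - exact: measurable_funeM.
    move=> w _; rewrite (_ : ((2 `^ q)%:E * _)%E =
      (2 `^ q * (`|V w : E| `^ q + c * `|(U w : E) - V w| ^+ 2))%:E)// lee_fin.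
    have s0' := normr_ge0 ((U w : E) - V w).
    have n0 : 0 <= n%:R :> R by [].
    have h1 := min_powR_le _ n%:R q s0' n0 q2.
    have v0 := normr_ge0 (V w : E); have u0 := normr_ge0 (U w : E).
    have tri : `|U w : E| <= `|V w : E| + `|(U w : E) - V w|.
      by rewrite -[X in `|X| <= _](subrK (V w : E)) addrC ler_normD.
    apply: (@le_trans _ _ ((`|V w : E| + Num.min `|(U w : E) - V w| n%:R) `^ q)).
      have m0 : 0 <= Num.min `|(U w : E) - V w| n%:R by rewrite le_min s0' n0.
      apply: ge0_ler_powR; rewrite ?nnegrE ?le_min ?u0 ?n0 ?addr_ge0//.
      move: tri v0 n0 s0'; set x := `|U w : E|; set y := `|V w : E|; set z := `|_ - _|.
      by rewrite /Order.min; case: ltP => h2; case: ltP => h3 *; lra.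
    apply: le_trans (powRD_le _ _ _ v0 _ q0) _; first by rewrite le_min s0' n0.
    by rewrite ler_wpM2l ?powR_ge0// lerD2l.
  rewrite ge0_integralZl_EFin ?powR_ge0// [X in (_ <= X)%E]EFinM.
  apply: lee_wpmul2l; first by rewrite lee_fin powR_ge0.
  rewrite ge0_integralD// [X in (_ <= X)%E]EFinD; apply: leeD; first by rewrite -momentE.
  rewrite ge0_integralZl_EFin//.
  apply: (@le_trans _ _ (c%:E * (eta ^+ 2)%:E)%E); first exact: lee_wpmul2l.
  rewrite -EFinM lee_fin /eta exprVn ler_pdivrMr ?exprn_gt0//; first by nra.
  lra.
have ndg w : nondecreasing_seq (fun n => (g n w)%:E).
  move=> a b ab; rewrite lee_fin; apply: ge0_ler_powR => //.
  - by rewrite nnegrE le_min normr_ge0 ler0n.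
  - by rewrite nnegrE le_min normr_ge0 ler0n.
  - by rewrite le_min !ge_min lexx ler_nat ab !orbT.
rewrite momentE.
have -> : (\int[P]_w (`|U w : E| `^ q)%:E = limn (fun n => \int[P]_w (g n w)%:E))%E.
  rewrite -monotone_convergence//.
  - apply: eq_integral => w _; apply/esym/cvg_lim => //.
    apply: cvg_near_cst; exists (Num.truncn `|U w : E|).+1 => // n /= Un.
    congr (_%:E); rewrite /g min_l//.
    by apply: ltW; apply: lt_le_trans (truncnS_gt _) _; rewrite ler_nat.
  - by move=> n w _; rewrite lee_fin powR_ge0.
apply: lime_le; last exact: nearW.
apply: ereal_nondecreasing_is_cvgn => a b ab; apply: ge0_le_integral => //.
  by move=> w _; rewrite lee_fin powR_ge0.
by move=> w _; exact: ndg.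
Qed.

End MomentApproximation.

(** * Powers in the limit, and times of small contraction rate *)

Section RealLimits.
Context {R : realType}.

Lemma cvg_powR0 {T : Type} (F : set_system T) {FF : Filter F} (g : T -> R) (a : R) :
  0 < a -> (\forall t \near F, 0 <= g t) -> g @ F --> 0 -> (g t `^ a) @[t --> F] --> 0.
Proof.
move=> a0 g0 gF; apply/cvgrPdist_lt => e e0.
have ea : 0 < e `^ a^-1 by rewrite powR_gt0.
move/cvgrPdist_lt : gF => /(_ _ ea) gF.
apply: filterS2 g0 gF => t gt0; rewrite !sub0r !normrN ger0_norm// ger0_norm ?powR_ge0// => gte.
have -> : e = (e `^ a^-1) `^ a by rewrite -powRrM mulVf ?gt_eqF// powRr1// ltW.
by apply: gt0_ltr_powR => //; rewrite nnegrE ltW.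
Qed.

(** If [rho] were at least [1 / (n + 1)] on all of [[n, +oo[], the integral of [rho^c] would be
    infinite; so a smaller value occurs at some time after [n]. *)
Lemma integrable_small_times (rho : R -> R) (c : R) :
  (forall t, 0 <= t -> 0 <= rho t) -> {within `[0, +oo[, continuous rho} -> 0 < c ->
  (\int[lebesgue_measure]_(t in `[0%R, +oo[) (rho t `^ c)%:E < +oo)%E ->
  exists t : nat -> R, [/\ forall n, 0 <= t n, forall n, n%:R <= t n &
    rho (t n) @[n --> \oo] --> 0].
Proof.
move=> rho0 crho c0 irho.
have H n : exists t : R, n%:R <= t /\ rho t < n.+1%:R^-1.
  apply/not_existsP => H.
  pose e : R := n.+1%:R^-1 `^ c.
  have e0 : 0 < e by rewrite powR_gt0// invr_gt0.
  have rhoe t : n%:R <= t -> e <= rho t `^ c.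
    move=> nt; have := H t => /not_andP[//|/negP]; rewrite -leNgt => h.
    apply: ge0_ler_powR => //; first exact: ltW.
      by rewrite nnegrE invr_ge0.
    by rewrite nnegrE; apply: rho0; apply: le_trans nt.
  move: irho; apply/negP; rewrite -leNgt.
  have -> : +oo%E = (\int[lebesgue_measure]_(t in `[n%:R, +oo[) e%:E)%E.
    rewrite integral_cst//= [X in (_ * X)%E](_ : _ = +oo%E) ?gt0_muley//.
    by rewrite (@lebesgue_measure_itv R `[n%:R, +oo[) /= ltry.
  have mr : measurable_fun (`[0, +oo[%classic : set R) (fun t : R => (rho t `^ c)%:E).
    apply/measurable_EFinP; apply: (measurableT_comp (f := @powR R ^~ c)).
      exact: measurable_powR.
    exact: subspace_continuous_measurable_fun.
  have sub : (`[n%:R, +oo[%classic : set R) `<=` `[0, +oo[%classic.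
    by move=> t /=; rewrite !in_itv/= !andbT; apply: le_trans.
  apply: (@le_trans _ _ (\int[lebesgue_measure]_(t in `[n%:R, +oo[) (rho t `^ c)%:E)%E).
    apply: ge0_le_integral => //.
    - by move=> t _; rewrite lee_fin ltW.
    - exact: measurable_funS mr.
    - by move=> t /=; rewrite in_itv/= andbT lee_fin; exact: rhoe.
  by apply: ge0_subset_integral => // t _; rewrite lee_fin powR_ge0.
pose t n := xget 0 [set t : R | n%:R <= t /\ rho t < n.+1%:R^-1].
have tP n : n%:R <= t n /\ rho (t n) < n.+1%:R^-1.
  by rewrite /t; case: xgetP => [? -> //|/(_ _) hn]; have [u hu] := H n; case: (hn u).
have t0 n : 0 <= t n by apply: le_trans (tP n).1.
exists t; split => //; first by move=> n; exact: (tP n).1.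
apply: (@squeeze_cvgr _ _ _ _ (cst 0) (fun n => n.+1%:R^-1)) => //.
- by apply: nearW => n; rewrite rho0//= ltW// (tP n).2.
- exact: cvg_cst.
- exact: cvg_harmonic.
Qed.

End RealLimits.

(** * Convergence to the invariant measure *)

Section BoundedFunctions.
Context {R : realType}.

Lemma bounded_integrable {d'} {T : measurableType d'} (Q : probability T R)
    (g : T -> R) (N : R) : measurable_fun [set: T] g ->
  (forall u, `|g u| <= N) -> Q.-integrable [set: T] (fun u => (g u)%:E).
Proof.
move=> mg gN; have iN : Q.-integrable [set: T] (EFin \o cst N).
  exact: finite_measure_integrable_cst.
apply: (le_integrable measurableT _ _ iN); first exact/measurable_EFinP.
by move=> u _; rewrite lee_fin (le_trans (gN u))// ler_norm.
Qed.

Lemma Rintegral_prob_cst {d'} {T : measurableType d'} (Q : probability T R) (c : R) :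
  \int[Q]_(_ in [set: T]) c = c.
Proof.
rewrite Rintegral_cst// [X in fine X](_ : _ = 1%E) ?mulr1//.
exact: probability_setT.
Qed.

Lemma norm_Rintegral_le_cst {d'} {T : measurableType d'} (Q : probability T R)
    (g : T -> R) (N : R) : measurable_fun [set: T] g ->
  (forall u, `|g u| <= N) -> `|\int[Q]_u g u| <= N.
Proof.
move=> mg gN; have ig := bounded_integrable Q g N mg gN.
apply: (le_trans (le_normr_Rintegral measurableT ig)).
rewrite -[leRHS](Rintegral_prob_cst Q); apply: le_Rintegral => //.
  exact: (integrable_norm ig).
exact: finite_measure_integrable_cst.
Qed.

End BoundedFunctions.

Section InvariantLimit.
Context {R : realType} {E : completeNormedModType R} (sepE : separable E).
Context {d : measure_display} {Omega : measurableType d} (P : probability Omega R).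
Context (X : E -> R -> {mfun Omega >-> borel E}) (mu : probability (borel E) R).
Hypothesis mkerX : forall t (A : set (borel E)), 0 <= t -> measurable A ->
  measurable_fun [set: borel E] (fun y : borel E => P (X y t @^-1` A)).
Hypothesis invmu : invariant_measure P X mu.

Let mean (g : E -> R) t y := \int[P]_w g (X y t w).

(** Under [mu] the identity is a variable of law [mu]; bundled as a measurable function, it makes
    invariance an instance of [disintegration_ge0]. *)
Let idE : borel E -> borel E := idfun.
HB.instance Definition _ := isMeasurableFun.Build _ _ _ _ idE (@measurable_id _ (borel E) setT).

Lemma invariant_integral (g : E -> R) (N t : R) : 0 <= t ->
  measurable_fun [set: borel E] (g : borel E -> R) -> (forall u, `|g u| <= N) ->
  measurable_fun [set: borel E] (mean g t : borel E -> R) /\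
  \int[mu]_y mean g t y = \int[mu]_y g y.
Proof.
move=> t0 mg gN.
(* The shift by [N] makes the integrand nonnegative; it cancels at the end because [P] and [mu] have
   mass 1. *)
pose k (u : E) := g u + N.
have k0 u : 0 <= k u by have := gN u; rewrite /k ler_norml => /andP[]; lra.
have mk : measurable_fun [set: borel E] (k : borel E -> R) by exact: measurable_funD.
have mke : measurable_fun [set: borel E] ((EFin \o k) : borel E -> \bar R).
  exact/measurable_EFinP.
have ig y : P.-integrable [set: Omega] (fun w => (g (X y t w))%:E).
  by apply: (bounded_integrable _ _ N) => //; exact: mfun_comp_measurable.
have iN : P.-integrable [set: Omega] (EFin \o cst N) by exact: finite_measure_integrable_cst.
have kE y : (\int[P]_w (EFin \o k) (X y t w) = (mean g t y + N)%:E)%E.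
  transitivity (\int[P]_w ((g (X y t w))%:E + N%:E))%E; first by [].
  rewrite integralD// integral_prob_cst EFinD; congr (_ + _)%E.
  by rewrite /mean /Rintegral fineK//; exact/integrable_fin_num.
have [mm0 int_eq0] := @disintegration_ge0 R _ _ _ _ (borel E) (borel E) (borel E) Omega
  mu idE setT mu setT P (fun y => X y t) measurableT measurableT
  (fun A mA => mkerX t A t0 mA)
  (fun A mA => etrans (congr1 mu (etrans (setTI _) (preimage_id A))) (invmu t A t0 mA))
  (EFin \o k) mke (fun y => k0 y).
have mm : measurable_fun [set: borel E] ((fun y => (mean g t y + N)%:E) : borel E -> \bar R).
  by apply: eq_measurable_fun mm0 => y _; exact: kE.
have int_eq : (\int[mu]_(w in [set: borel E]) (EFin \o k) (idE w) =
    \int[mu]_y (mean g t y + N)%:E)%E.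
  by rewrite int_eq0; apply: eq_integral => y _; exact: kE.
have mmean : measurable_fun [set: borel E] (mean g t : borel E -> R).
  have -> : mean g t = (fun y => (mean g t y + N) - N).
    by apply/funext => y; rewrite addrK.
  have /measurable_EFinP mm' := mm.
  exact: measurable_funB mm' (measurable_cst _).
split => //.
have meanN y : `|mean g t y| <= N.
  by apply: norm_Rintegral_le_cst => //; exact: mfun_comp_measurable.
have i1 := bounded_integrable mu _ N mmean meanN.
have i2 := bounded_integrable mu _ N mg gN.
have iNmu : mu.-integrable [set: borel E] (EFin \o cst N) by exact: finite_measure_integrable_cst.
move: int_eq.
have -> : (\int[mu]_(w in [set: borel E]) (EFin \o k) (idE w) = \int[mu]_w ((g w)%:E + N%:E))%E by [].
have -> : (\int[mu]_w (mean g t w + N)%:E = \int[mu]_w ((mean g t w)%:E + N%:E))%E by [].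
rewrite !integralD// integral_prob_cst => e.
rewrite /Rintegral; congr fine.
have := congr1 (fun z => z - N%:E)%E e.
by rewrite !addeK.
Qed.

Context (p gamma b L beta : R) (rho : R -> R) (a : E -> R) (t : nat -> R).
Hypothesis bg : 0 < b <= gamma.
Hypothesis g1 : gamma <= 1.
Hypothesis L0 : 0 < L.
Hypothesis momX : forall y s, 0 <= s -> (moment P p (X y s) <= (a y)%:E)%E.
Hypothesis contrX : forall y z s, 0 <= s ->
  (L2dist P (X y s) (X z s) <=
   (L * `|y - z| * (1 + `|y| `^ beta + `|z| `^ beta) * rho s)%:E)%E.
Hypothesis rho0 : forall s, 0 <= s -> 0 <= rho s.
Hypothesis t0 : forall n, 0 <= t n.
Hypothesis rhot : rho (t n) @[n --> \oo] --> 0.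

(** By invariance [mean g (t n)] has the same [mu]-integral as [g], so the distance to the limit is
    at most the [mu]-mean of [D n]. Contraction sends [D n y] to 0 for each [y], and [2 N]
    dominates, so the constants that depend on [y] are never integrated. *)
Lemma bounded_mean_cvg (g : E -> R) (K N : R) (x : E) : 0 <= K -> continuous g ->
  (forall u, `|g u| <= N) -> (forall u v, `|g u - g v| <= K * dpg p gamma u v) ->
  mean g (t n) x @[n --> \oo] --> \int[mu]_u g u.
Proof.
move=> K0 cg gN gK.
have mg : measurable_fun [set: borel E] (g : borel E -> R) by exact: continuous_borel_measurable.
have ig y n : P.-integrable [set: Omega] (fun w => (g (X y (t n) w))%:E).
  by apply: (bounded_integrable _ _ N) => //; exact: mfun_comp_measurable.
have mm n := (invariant_integral g N (t n) (t0 n) mg gN).1.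
have em n := (invariant_integral g N (t n) (t0 n) mg gN).2.
have meanN n y : `|mean g (t n) y| <= N.
  by apply: norm_Rintegral_le_cst => //; exact: mfun_comp_measurable.
have b0 : 0 < b by case/andP: bg.
pose D n (y : E) := `|mean g (t n) y - mean g (t n) x|.
have D_cvg y : D n y @[n --> \oo] --> 0.
  pose l := L * `|y - x| * (1 + `|y| `^ beta + `|x| `^ beta).
  have l0 : 0 <= l.
    by rewrite !mulr_ge0 ?addr_ge0 ?powR_ge0// ltW.
  have Dle n : D n y <= K * ((l * rho (t n)) `^ b / 2) * (3 + a y + a x).
    have iB : P.-integrable [set: Omega]
        (EFin \o (fun w => g (X y (t n) w) - g (X x (t n) w))).
      exact: (integrableB measurableT (ig y n) (ig x n)).
    rewrite /D /mean -RintegralB//; last 2 first.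
    - exact: ig.
    - exact: ig.
    apply: (le_trans (le_normr_Rintegral measurableT iB)).
    rewrite -lee_fin /Rintegral fineK; last exact/integrable_fin_num/integrable_norm.
    apply: (@dist_expectation_le _ _ _ _ P g K p gamma b) => //.
    + by rewrite mulr_ge0// rho0.
    + exact: contrX.
    + exact: momX.
    + exact: momX.
  apply: (@squeeze_cvgr _ _ _ _ (cst 0)
    (fun n => K * ((l * rho (t n)) `^ b / 2) * (3 + a y + a x))).
  - by apply: nearW => n; rewrite Dle normr_ge0.
  - exact: cvg_cst.
  have h : (l * rho (t n)) `^ b @[n --> \oo] --> (0 : R).
    apply: cvg_powR0 => //.
      by apply: nearW => n; rewrite mulr_ge0// rho0.
    by rewrite -[0](mulr0 l); exact: cvgMl_tmp.
  rewrite -[0](mul0r (3 + a y + a x)); apply: cvgMr_tmp.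
  rewrite -[0](mulr0 K); apply: cvgMl_tmp.
  by rewrite -[0](mul0r (2^-1)); apply: cvgMr_tmp.
have mD n : measurable_fun [set: borel E] (D n : borel E -> R).
  by apply: measurableT_comp => //; apply: measurable_funB.
have DN n y : `|D n y| <= 2 * N.
  rewrite normr_id (le_trans (ler_normB _ _))// mulr2n mulrDl !mul1r lerD//.
have iD n := bounded_integrable mu _ _ (mD n) (DN n).
have intD : \int[mu]_y D n y @[n --> \oo] --> 0.
  have i2N : mu.-integrable [set: borel E] (EFin \o cst (2 * N)).
    exact: finite_measure_integrable_cst.
  have := @dominated_cvg _ (borel E) R mu setT measurableT (fun n y => (D n y)%:E)
    (cst 0%E) (EFin \o cst (2 * N)) _ _ _ i2N _.
  rewrite integral0 => H; apply: (fine_cvg (a := 0)); apply: H => //.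
  - by move=> n; exact/measurable_EFinP.
  - by move=> y _; apply: cvg_EFin; [exact: nearW|exact: D_cvg].
  - by move=> n y _; rewrite lee_fin.
apply/cvgrPdist_le => eps eps0.
move/cvgrPdist_le : intD => /(_ _ eps0); apply: filterS => n; rewrite sub0r normrN => Dn.
rewrite -(em n) distrC.
have ix : mu.-integrable [set: borel E] (EFin \o cst (mean g (t n) x)).
  exact: finite_measure_integrable_cst.
have iy := bounded_integrable mu _ _ (mm n) (meanN n).
have iB : mu.-integrable [set: borel E] (EFin \o (fun y => mean g (t n) y - mean g (t n) x)).
  exact: (integrableB measurableT iy ix).
have -> : mean g (t n) x - \int[mu]_y mean g (t n) y =
    - \int[mu]_y (mean g (t n) y - mean g (t n) x).
  by rewrite RintegralB// Rintegral_prob_cst opprB.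
rewrite normrN; apply: (le_trans (le_normr_Rintegral measurableT iB)).
exact: le_trans (ler_norm _) Dn.
Qed.

(** The second moment bound [C2] acts twice: it bounds the [mu]-means of the truncations of [|f|],
    which yields integrability by monotone convergence, and it makes the truncation error at most
    [C2 / k] for all [n], so that the limits in [k] and [n] can be combined. *)
Lemma mean_cvg_invariant (f : E -> R) (K C2 : R) (x : E) : 0 <= K -> continuous f ->
  (forall u v, `|f u - f v| <= K * dpg p gamma u v) ->
  (forall n, P.-integrable [set: Omega] (fun w => (f (X x (t n) w))%:E)) ->
  (forall n, P.-integrable [set: Omega] (fun w => (f (X x (t n) w) ^+ 2)%:E)) ->
  (forall n, \int[P]_w (f (X x (t n) w) ^+ 2) <= C2) ->
  mu.-integrable [set: borel E] (fun u : borel E => (f u)%:E) /\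
  (mean f (t n) x @[n --> \oo] --> \int[mu]_u f u).
Proof.
move=> K0 cf fK i_f i_f2 f2C.
have mf : measurable_fun [set: borel E] (f : borel E -> R) by exact: continuous_borel_measurable.
pose T k (u : E) : R := Num.min k%:R (Num.max (- k%:R) (f u)).
have cT k : continuous (T k).
  move=> u; apply: (@continuous_min R E (cst k%:R)); first exact: cvg_cst.
  by apply: (@continuous_max R E (cst (- k%:R))); [exact: cvg_cst|exact: cf].
have TK k u v : `|T k u - T k v| <= K * dpg p gamma u v by exact: min_dpg_contract.
have TE k u : `|T k u| = Num.min k%:R `|f u| by exact: norm_trunc.
have TN k u : `|T k u| <= k%:R by rewrite TE ge_min lexx.
have Tf k u : `|T k u| <= `|f u| by rewrite TE ge_min lexx orbT.
have mT k : measurable_fun [set: borel E] (T k : borel E -> R) by exact: continuous_borel_measurable.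
have iT k n : P.-integrable [set: Omega] (fun w => (T k (X x (t n) w))%:E).
  by apply: (bounded_integrable _ _ k%:R) => //; exact: mfun_comp_measurable.
have T_cvg u : (T k u)%:E @[k --> \oo] --> (f u)%:E.
  apply: cvg_near_cst; exists (Num.truncn `|f u|).+1 => // k /= uk.
  have : `|f u| <= k%:R.
    by apply: ltW; apply: lt_le_trans (truncnS_gt _) _; rewrite ler_nat.
  by rewrite ler_norml => /andP[h1 h2]; rewrite /T max_r// min_r.
(* [|T k|] is again bounded with the same [dpg] estimate, so its [mu]-mean is the limit of its means
   along [t n], and these are bounded through [|c| <= 1 + c^2]. *)
have absT k : (\int[mu]_u `|T k u|%:E <= (1 + C2)%:E)%E.
  have nT : continuous (fun u => `|T k u|) by move=> u; apply: cvg_norm; exact: cT.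
  have nTN u : `| `|T k u| | <= k%:R by rewrite normr_id.
  have nTK u v : `| `|T k u| - `|T k v| | <= K * dpg p gamma u v.
    exact: le_trans (ler_dist_dist _ _) (TK _ _ _).
  have nTc := bounded_mean_cvg _ K k%:R x K0 nT nTN nTK.
  have mnT := continuous_borel_measurable _ nT.
  have iTmu := bounded_integrable mu _ _ mnT nTN.
  have -> : (\int[mu]_u `|T k u|%:E = (\int[mu]_u `|T k u|)%:E)%E.
    by rewrite /Rintegral fineK//; exact: (integrable_fin_num measurableT iTmu).
  rewrite lee_fin -(cvg_lim _ nTc)//; apply: limr_le; first by apply/cvg_ex; eexists; exact: nTc.
  apply: nearW => n.
  have i1 : P.-integrable [set: Omega] (EFin \o cst (1 : R)).
    exact: finite_measure_integrable_cst.
  have i2 := i_f2 n.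
  apply: (@le_trans _ _ (\int[P]_w (1 + f (X x (t n) w) ^+ 2))).
    apply: le_Rintegral => //.
    - exact: (integrable_norm (iT k n)).
    - exact: (integrableD measurableT i1 i2).
    - move=> w _; apply: le_trans (Tf _ _) _.
      have := sqr_ge0 (`|f (X x (t n) w)| - 1); rewrite sqrrB1 real_normK ?num_real//.
      have := normr_ge0 (f (X x (t n) w)); lra.
  by rewrite RintegralD// Rintegral_prob_cst lerD2l.
have imf : mu.-integrable [set: borel E] (fun u : borel E => (f u)%:E).
  apply/integrableP; split; first exact/measurable_EFinP.
  have -> : (\int[mu]_u `|(f u)%:E| = limn (fun k => \int[mu]_u `|T k u|%:E))%E.
    rewrite -monotone_convergence//.
    - apply: eq_integral => u _; apply/esym/cvg_lim => //.
      exact: (cvg_abse (T_cvg u)).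
    - by move=> k; apply/measurable_EFinP; apply: measurableT_comp.
    - move=> u _ k l kl; rewrite lee_fin !TE le_min !ge_min ler_nat kl lexx orbT//.
  apply: le_lt_trans (ltry (1 + C2)); apply: lime_le; last exact: nearW.
  apply: ereal_nondecreasing_is_cvgn => k l kl; apply: ge0_le_integral => //.
  - by apply/measurable_EFinP; apply: measurableT_comp.
  - by apply/measurable_EFinP; apply: measurableT_comp.
  - by move=> u _; rewrite lee_fin !TE le_min !ge_min ler_nat kl lexx orbT.
split => //.
have iTmu k := bounded_integrable mu _ _ (mT k) (TN k).
have Tmu_cvg : \int[mu]_u T k u @[k --> \oo] --> \int[mu]_u f u.
  have inf : mu.-integrable [set: borel E] (fun u : borel E => `|f u|%:E).
    exact: (integrable_norm imf).
  apply: (fine_cvg (a := \int[mu]_u f u)).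
  rewrite /Rintegral fineK; last exact: (integrable_fin_num measurableT imf).
  apply: (@dominated_cvg _ (borel E) R mu setT measurableT (fun k u => (T k u)%:E)
    (fun u => (f u)%:E) (fun u => `|f u|%:E)) => //.
    by move=> k; exact/measurable_EFinP.
  by move=> k u _; rewrite lee_fin.
apply/cvgrPdist_le => eps eps0.
have e3 : 0 < eps / 3 by lra.
move/cvgrPdist_le : Tmu_cvg => /(_ _ e3)[k0 _ Hk0].
have C20 : 0 <= C2.
  by apply: le_trans (f2C 0); apply: Rintegral_ge0 => w _; exact: sqr_ge0.
(* [k0] brings the [mu]-mean of the truncation close to that of [f]; the other entry makes [C2 / k]
   at most [eps / 3]. *)
pose k := maxn k0 (Num.truncn (C2 / (eps / 3))).+1.
have kC : C2 / k%:R <= eps / 3.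
  have k_gt0 : 0 < k%:R :> R by rewrite ltr0n /k leq_max orbT.
  rewrite ler_pdivrMr// mulrC -ler_pdivrMr//; apply: ltW.
  by apply: lt_le_trans (truncnS_gt _) _; rewrite ler_nat leq_maxr.
have := Hk0 k (leq_maxl _ _) => /= hk1.
have := bounded_mean_cvg (T k) K k%:R x K0 (cT k) (TN k) (TK k).
move/cvgrPdist_le => /(_ _ e3); apply: filterS => n hk2.
have hk3 : `|mean (T k) (t n) x - mean f (t n) x| <= eps / 3.
  apply: le_trans kC.
  have iB : P.-integrable [set: Omega]
      (EFin \o (fun w => T k (X x (t n) w) - f (X x (t n) w))).
    exact: (integrableB measurableT (iT k n) (i_f n)).
  have j1 := iT k n; have j2 := i_f n; rewrite /mean -RintegralB//.
  apply: (le_trans (le_normr_Rintegral measurableT iB)).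
  apply: (@le_trans _ _ (\int[P]_w (k%:R^-1 * f (X x (t n) w) ^+ 2))).
    apply: le_Rintegral => //.
    - exact: (integrable_norm iB).
    - exact: (integrableZl measurableT k%:R^-1 (i_f2 n)).
    - by move=> w _; rewrite distrC; apply: trunc_error; rewrite ltr0n /k leq_max orbT.
  have j3 := i_f2 n; by rewrite RintegralZl// mulrC ler_wpM2r ?invr_ge0.
rewrite (_ : \int[mu]_u f u - _ = (\int[mu]_u f u - \int[mu]_u T k u) +
  (\int[mu]_u T k u - mean (T k) (t n) x) + (mean (T k) (t n) x - mean f (t n) x)); last by ring.
apply: le_trans (ler_normD _ _) _.
have -> : eps = eps / 3 + eps / 3 + eps / 3 by field.
apply: lerD => //; apply: le_trans (ler_normD _ _) _; exact: lerD.
Qed.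

End InvariantLimit.

(** * The limit of the step-sizes *)

Theorem theorem3p1 (R : realType) (E : completeNormedModType R)
  (sepE : separable E)
  (d : measure_display) (Omega : measurableType d) (P : probability Omega R)
  (F : R -> set (set Omega)) (filtF : filtration F)
  (X : E -> R -> {mfun Omega >-> borel E}) (markovX : markov_process P F X)
  (Eh : R -> set E) (proj : R -> E -> E)
  (spaceEh : discretization_space Eh proj)
  (Y : R * R -> E -> nat -> {mfun Omega >-> borel E})
  (r rt L1 gamma1 beta L2 : R) (rho : R -> R)
  (A1 : condA1 P X r rt L1 gamma1 beta L2 rho)
  (D0 : R * R) (q qt L3 gamma2 kappa L4 : R) (rhoD : R * R -> R -> R)
  (A2 : condA2 P Eh Y D0 q qt L3 gamma2 kappa L4 rhoD)
  (alpha1 alpha2 L5 : R)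
  (A3 : condA3 P X proj Y D0 rt qt alpha1 alpha2 L5)
  (gamma : R) (hgamma : gamma2 <= gamma <= 1)
  (p : R) (hp : 1 <= p)
  (hpq : p * (1 + qt) + 2 * (1 + kappa) * gamma <= q)
  (mu : probability (borel E) R) (hmu : unique_invariant_measure P X mu)
  (f : E -> R) (hf : Cpg p gamma f) (x : E) :
  exists Z : R * R -> Omega -> R,
    (forall D, steps D0 D ->
       measurable_fun [set: Omega] (Z D) /\
       {ae P, forall w,
          time_average f (Y D (proj D.1 x)) k w @[k --> \oo] --> Z D w}) /\
    {ae P, forall w,
       (Z D w)%:E @[D --> within (steps D0) (nbhs ((0, 0) : R * R))] -->
       (\int[mu]_u (f u)%:E)%E}.
Proof.
have /andP[b0 b1] := A2_gamma2 A2; have /andP[bg g1] := hgamma.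
have bgP : 0 < gamma2 <= gamma by rewrite b0.
have g0 : 0 < gamma by exact: lt_le_trans bg.
have [cf _] := hf.
have [K K0 [fK fd]] := Cpg_bounds p gamma f g0 hf.
have q2 := A2_q A2; have qt1 := A2_qt A2; have L30 := A2_L3 A2; have L40 := A2_L4 A2.
have L50 := A3_L5 A3; have [al1 al2] := A3_alpha A3.
have /andP[kappa0 _] := A2_kappa A2.
have [/andP[D010 D011] /andP[D020 D021]] := A2_range A2.
have q0 : 0 < q by lra.
have p_q : p <= q.
  have h1 : 0 <= (1 + kappa) * gamma by rewrite mulr_ge0 ?ltW//; lra.
  have h2 : 0 <= p * qt by rewrite mulr_ge0//; lra.
  lra.
have pqP : 0 < p <= q by apply/andP; split => //; lra.
have qtq0 : 0 <= qt * q by rewrite mulr_ge0//; lra.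
have p20 : 0 <= p / 2 by lra.
have pq0 : 0 <= p <= q by apply/andP; split => //; lra.
have pq2 : 0 <= p / 2 <= q by apply/andP; split => //; lra.
pose w0 y := 1 + `|y : E| `^ Num.max rt qt.
have w00 y : 0 < w0 y by rewrite ltr_wpDr ?powR_ge0.
pose dl (y : E) (D : R * R) := L5 * w0 y * (D.1 `^ alpha1 + D.2 `^ alpha2).
have dl0 y D : 0 <= dl y D.
  by rewrite mulr_ge0 ?addr_ge0 ?powR_ge0// mulr_ge0// ltW.
pose mY (y : E) := L3 * (1 + `|y| `^ (qt * q)).
have mY0 y : 0 < mY y by rewrite mulr_gt0// ltr_wpDr ?powR_ge0.
have momX y t : 0 <= t -> (moment P q (X y t) <= (2 `^ q * (mY y + 1))%:E)%E.
  move=> t0; apply: le_moment_approx => //; first exact: ltW.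
  move=> eta eta0; pose c := L5 * w0 y.
  have c0 : 0 < c by rewrite mulr_gt0.
  (* With [h = 0] the chain starts at [y] itself and the spatial error is 0; [s] solves
     [c * s^alpha2 = eta]. *)
  pose s := (eta / c) `^ alpha2^-1.
  have s0 : 0 < s by rewrite powR_gt0// divr_gt0.
  pose tau := Num.min D0.2 s.
  have tau0 : 0 < tau by rewrite lt_min D020.
  have st : steps D0 (0, tau).
    by split; rewrite /= ?lexx ?D010 ?tau0//= ge_min lexx.
  have Eh0 : Eh 0 y by rewrite (space0 spaceEh).
  have py : proj 0 y = y by apply: (proj_id spaceEh) => //; rewrite lexx ler01.
  exists (step_process tau (Y (0, tau) (proj 0 y)) t); split.
    by rewrite py /step_process; exact: (A2_moment A2 _ st).
  apply: le_trans (A3_error A3 y st t0) _; rewrite lee_fin /=.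
  rewrite powR0 ?gt_eqF// add0r -/(w0 y) -/c mulrC -ler_pdivlMr//.
  have -> : eta / c = s `^ alpha2.
    by rewrite /s -powRrM mulVf ?gt_eqF// powRr1// divr_ge0// ltW.
  apply: ge0_ler_powR; rewrite ?nnegrE; first exact: ltW.
  - exact: ltW.
  - exact: ltW.
  - by rewrite ge_min lexx orbT.
pose mX (y : E) := 2 `^ q * (mY y + 1).
have mX0 y : 0 < mX y by rewrite mulr_gt0 ?powR_gt0// addr_gt0.
have momXp y t : 0 <= t -> (moment P p (X y t) <= (2 * mX y `^ (p / q))%:E)%E.
  by move=> t0; apply: le_moment_interp => //; exact: momX.
have /andP[c0 _] := A1_gamma1 A1.
have [t [t0 tn rhot]] := integrable_small_times rho gamma1 (A1_rho_ge0 A1)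
  (A1_rho_cont A1) c0 (A1_rho_int A1).
have mf : measurable_fun [set: borel E] (f : borel E -> R) by exact: continuous_borel_measurable.
have fK2 u : `|f u| <= 2 * K * (1 + `|u|) `^ (p / 2).
  by apply: (le_trans (fK u)); exact: one_add_powR_le.
have ifX n := integrable_poly_growth P (X x (t n)) f _ q _ _ mf fK2 pq2 (momX x _ (t0 n)).
pose f2 (u : E) := f u ^+ 2.
have mf2 : measurable_fun [set: borel E] (f2 : borel E -> R) by exact: measurable_funX.
have f2K u : `|f2 u| <= (2 * K) ^+ 2 * (1 + `|u|) `^ p.
  rewrite /f2 ger0_norm ?sqr_ge0// -real_normK ?num_real//.
  have -> : (1 + `|u|) `^ p = ((1 + `|u|) `^ (p / 2)) ^+ 2.
    by rewrite -powR_mulrn ?powR_ge0// -powRrM divfK.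
  by rewrite -exprMn lerXn2r ?nnegrE// mulr_ge0 ?powR_ge0// mulr_ge0.
have if2X n := integrable_poly_growth P (X x (t n)) f2 _ q p _ mf2 f2K pq0 (momX x _ (t0 n)).
have f2C n : \int[P]_w (f (X x (t n) w) ^+ 2) <= (2 * K) ^+ 2 * (2 `^ q * (1 + mX x)).
  have := Rintegral_poly_growth_le P (X x (t n)) f2 _ q p _ mf2 (sqr_ge0 _) f2K pq0 (momX x _ (t0 n)).
  by under eq_Rintegral do rewrite /f2 ger0_norm ?sqr_ge0//.
have [imf mean_cvg] := mean_cvg_invariant sepE P X mu
  (fun s A s0 mA => markov_kernel markovX s0 mA) hmu.1 p gamma gamma2 L2 beta rho
  (fun y => 2 * mX y `^ (p / q)) t bgP g1 (A1_L2 A1) momXp (A1_contr A1)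
  (A1_rho_ge0 A1) t0 rhot f K _ x K0 cf fd ifX if2X f2C.
set I := \int[mu]_u f u in mean_cvg.
(* [bx] bounds [|proj D.1 x|] for all step-sizes, the 2 being a bound for [h^alpha1 + tau^alpha2].
   This makes the moment factor [A] independent of [D]. *)
pose bx := `|x| + L5 * w0 x * 2.
pose A := 3 + 2 * mX x `^ (p / q) + 2 * (L3 * (1 + bx `^ (qt * q))) `^ (p / q).
have key D : steps D0 D -> exists a : R,
    {ae P, forall w, time_average f (Y D (proj D.1 x)) k w @[k --> \oo] --> a} /\
    `|I - a| <= K * (dl x D `^ gamma2 / 2) * A.
  move=> st; have [/andP[h0 hD] /andP[tau0 tauD]] := st.
  have h1 : 0 <= D.1 <= 1 by rewrite h0 (le_trans hD).
  have mS : measurable (Eh D.1 : set (borel E)).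
    have [->|hn0] := eqVneq D.1 0; first by rewrite (space0 spaceEh); exact: measurableT.
    apply: finite_dim_subspace_measurable; apply: (space_finite_dim spaceEh).
    by rewrite lt_neqAle eq_sym hn0 h0 (le_trans hD).
  have Sx := proj_in spaceEh x h1.
  pose rk k := rhoD D (k%:R * D.2).
  have tk0 k : 0 <= k%:R * D.2 by rewrite mulr_ge0// ltW.
  have rk0 k : 0 <= rk k by exact: (A2_rho_ge0 A2).
  have [B rB] : exists B, forall n, \sum_(0 <= k < n) rk k `^ gamma2 <= B.
    have := A2_rho_sum A2; set Sp := ereal_sup _ => Spoo.
    have SpD : (D.2%:E * \sum_(0 <= k <oo) (rk k `^ gamma2)%:E <= Sp)%E.
      by apply: ereal_sup_ubound; exists D.
    (* This bound blows up as [tau] tends to 0, but it serves a fixed [D] only: the estimate of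
       [|I - a|] does not contain [B]. *)
    exists (fine Sp / D.2) => n.
    have s0 k : (0 <= (rk k `^ gamma2)%:E)%E by rewrite lee_fin powR_ge0.
    have Sp0 : (0 <= Sp)%E.
      apply: le_trans SpD; apply: mule_ge0; first by rewrite lee_fin ltW.
      exact: nneseries_ge0.
    rewrite ler_pdivlMr// mulrC -lee_fin fineK ?ge0_fin_numE//.
    apply: le_trans SpD; rewrite EFinM; apply: lee_wpmul2l; first by rewrite lee_fin ltW.
    by rewrite -sumEFin; apply: nneseries_lim_ge.
  have [a ea eay] := @chain_mean_cvg R E sepE d Omega P (Eh D.1) (Y D) mS
    (A2_markov A2 st) f K p gamma gamma2 q qt kappa L3 L4 B rk cf K0 fK fd bgP g1 hp qt1
    kappa0 L30 L40 hpq rk0 rB (fun y k Sy => A2_moment A2 k st Sy)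
    (fun y z k Sy Sz => A2_contr A2 k st Sy Sz) (proj D.1 x) Sx.
  exists a; split.
    apply: (@chain_time_average_cvg R E d Omega P (Eh D.1) (Y D) mS
      (A2_markov A2 st) f K p gamma gamma2 q qt kappa L3 L4 B rk) => //.
    by move=> y k Sy; exact: (A2_moment A2 k st Sy).
  have dl2 : dl x D <= L5 * w0 x * 2.
    have lw0 : 0 <= L5 * w0 x by rewrite ltW// mulr_gt0.
    rewrite /dl ler_wpM2l//.
    have H (u v : R) : 0 <= u -> u <= 1 -> 0 < v -> u `^ v <= 1.
      move=> u0 u1 v0; have := @ge0_ler_powR _ v (ltW v0) u 1.
      by rewrite !nnegrE powR1 ler01 u0 u1 => ->.
    rewrite (_ : 2 = 1 + 1)//; apply: lerD; first exact: H h0 (le_trans hD D011) al1.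
    exact: H (ltW tau0) (le_trans tauD D021) al2.
  (* At [t = 0] both processes are deterministic, so (A3) reads [|x - proj D.1 x| <= dl x D]. *)
  have pxb : `|proj D.1 x| <= bx.
    have := A3_error A3 x st (lexx 0); rewrite -/(w0 x) -/(dl x D) => e0.
    have := L2dist_sqr P _ _ _ (dl0 x D) e0.
    rewrite /step_process mul0r truncn0.
    under eq_integral => w _.
      rewrite (markov_start markovX)// (markov_start (A2_markov A2 st))//; over.
    rewrite integral_prob_cst lee_fin => e1.
    have e2 : `|x - proj D.1 x| <= dl x D.
      by rewrite -(ler_pXn2r (_ : 0 < 2)%N) ?nnegrE.
    have := ler_normB x (x - proj D.1 x); rewrite subKr => /le_trans; apply.
    by rewrite lerD2l (le_trans e2).
  have a2 k : (moment P p (Y D (proj D.1 x) k) <=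
      (2 * (L3 * (1 + bx `^ (qt * q))) `^ (p / q))%:E)%E.
    apply: le_moment_interp => //.
      by rewrite mulr_gt0// ltr_wpDr ?powR_ge0.
    apply: le_trans (A2_moment A2 k st Sx) _; rewrite lee_fin ler_wpM2l ?(ltW L30)// lerD2l.
    apply: ge0_ler_powR => //; rewrite ?nnegrE//.
    - exact: le_trans pxb.
  (* The piecewise constant chain at time [t n] is its state of index [kn n]; since [t n >= n],
     these indices tend to infinity and the means along them tend to [a]. *)
  pose kn n := Num.truncn (t n / D.2).
  have kn_cvg : kn n @[n --> \oo] --> \oo.
    apply/cvgnyPge => N; exists (Num.truncn (N%:R * D.2)).+1 => // n /= Nn.
    rewrite /kn truncn_ge_nat ?divr_ge0 ?(ltW tau0)// ler_pdivlMr//.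
    apply: le_trans (tn n); apply: ltW; apply: lt_le_trans (truncnS_gt _) _.
    by rewrite ler_nat.
  have eYa : \int[P]_w f (Y D (proj D.1 x) (kn n) w) @[n --> \oo] --> a.
    exact: (cvg_comp _ _ kn_cvg ea).
  have ifY k := integrable_poly_growth P _ f _ q _ _ mf fK2 pq2 (A2_moment A2 k st Sx).
  have lim_h : `|\int[P]_w f (X x (t n) w) - \int[P]_w f (Y D (proj D.1 x) (kn n) w)|
      @[n --> \oo] --> `|I - a| by apply: cvg_norm; exact: cvgB mean_cvg eYa.
  rewrite -(cvg_lim _ lim_h)//; apply: limr_le; first by apply/cvg_ex; eexists; exact: lim_h.
  apply: nearW => n; have j1 := ifX n; have j2 := ifY (kn n).
  have iB : P.-integrable [set: Omega]
      (EFin \o (fun w => f (X x (t n) w) - f (Y D (proj D.1 x) (kn n) w))).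
    exact: (integrableB measurableT j1 j2).
  rewrite -RintegralB//; apply: (le_trans (le_normr_Rintegral measurableT iB)).
  rewrite -lee_fin /Rintegral fineK; last exact/integrable_fin_num/integrable_norm.
  apply: (@dist_expectation_le _ _ _ _ P f K p gamma gamma2) => //.
  + exact: (A3_error A3).
  + exact: momXp.
(* Outside [steps D0] the default value 0 may occur; the filter within [steps D0] never sees it. *)
pose aD D := xget 0 [set a : R |
    {ae P, forall w, time_average f (Y D (proj D.1 x)) k w @[k --> \oo] --> a} /\
    `|I - a| <= K * (dl x D `^ gamma2 / 2) * A].
have aDP D : steps D0 D ->
    {ae P, forall w, time_average f (Y D (proj D.1 x)) k w @[k --> \oo] --> aD D} /\
    `|I - aD D| <= K * (dl x D `^ gamma2 / 2) * A.
  move=> st; have [a Ha] := key D st; rewrite /aD.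
  by case: xgetP => [? -> //|/(_ a)].
(* As [aD D] does not depend on [w], the outer limit holds at every [w], and the null sets of the
   inner limits, one for each of uncountably many step-sizes, need not be united. *)
exists (fun D _ => aD D); split=> [D st|].
  by split; [exact: measurable_cst|exact: (aDP D st).1].
apply: aeW => w.
have -> : (\int[mu]_u (f u)%:E = I%:E)%E.
  by rewrite /I /Rintegral fineK//; exact: (integrable_fin_num measurableT imf).
apply: cvg_EFin; first exact: nearW.
pose W := within (steps D0) (nbhs ((0, 0) : R * R)).
have fst0 : (fun D : R * R => D.1) @ W --> (0 : R).
  apply: cvg_within_filter; exact: cvg_fst.
have snd0 : (fun D : R * R => D.2) @ W --> (0 : R).
  apply: cvg_within_filter; exact: cvg_snd.
have stW : \forall D \near W, steps D0 D by exact: withinT.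
have p1 : (fun D : R * R => D.1 `^ alpha1) @ W --> (0 : R).
  by apply: cvg_powR0 => //; apply: filterS stW => D [/andP[]].
have p2 : (fun D : R * R => D.2 `^ alpha2) @ W --> (0 : R).
  by apply: cvg_powR0 => //; apply: filterS stW => D [_ /andP[/ltW]].
have dlW : dl x D `^ gamma2 @[D --> W] --> (0 : R).
  apply: cvg_powR0 => //; first exact: nearW.
  rewrite -[0](mulr0 (L5 * w0 x)); apply: cvgMl_tmp.
  by rewrite -[0](addr0 0); exact: cvgD.
have bW : K * (dl x D `^ gamma2 / 2) * A @[D --> W] --> (0 : R).
  rewrite -[0](mul0r A); apply: cvgMr_tmp; rewrite -[0](mulr0 K); apply: cvgMl_tmp.
  by rewrite -[0](mul0r (2^-1)); apply: cvgMr_tmp.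
apply/cvgrPdist_le => eps eps0.
move/cvgrPdist_le : bW => /(_ _ eps0) bW.
apply: filterS2 stW bW => D st; rewrite sub0r normrN => H.
apply: le_trans (aDP D st).2 _; exact: le_trans (ler_norm _) H.
Qed.
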